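(* Let $n\ge 2$ and $e\geq 1$ be integers and let $X\subset\mathbb{P}^n_{\mathbb{C}}$ be a smooth hypersurface of degree $d$. If $$d>\frac{n(n-1)}{2e}+n+1,$$ then the degree $e$ rational curve sections of $X$ vary maximally in modulus, i.e. the rational map $$\Phi:\operatorname{Mor}_e(\mathbb{P}^1,\mathbb{P}^n)\dashrightarrow\mathbb{P}H^0(\mathbb{P}^1,\mathscr{O}_{\mathbb{P}^1}(ed)),\qquad\iota\mapsto[\iota^{-1}(X)]$$ has maximal rank.
   Context: Everything is over $\mathbb{C}$. $\operatorname{Mor}_e(\mathbb{P}^1,\mathbb{P}^n)$ is the variety of morphisms $\iota:\mathbb{P}^1\to\mathbb{P}^n$ with $\iota^*\mathscr{O}(1)=\mathscr{O}(e)$, i.e. the open subset of $\mathbb{P}(H^0(\mathscr{O}_{\mathbb{P}^1}(e))^{\oplus n+1})$ of tuples of degree $e$ binary forms without common zero. If $X=\{F=0\}$, the map $\Phi$ sends $\iota$ to the class of $\iota^*F$; it is defined when $\iota(\mathbb{P}^1)\not\subset X$. $\Phi$ has maximal rank if the dimension of its image is the minimum of the dimensions of its source and target; equivalently, the derivative of $\Phi$ at a general point has maximum rank. *)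

(* Defs.v *)
From HB Require Import structures.
From mathcomp Require Import all_boot all_order all_algebra.
From mathcomp Require Import mpoly.

Set Implicit Arguments.
Unset Strict Implicit.
Unset Printing Implicit Defensive.

Import GRing.Theory.
Local Open Scope ring_scope.

Section ProjectiveDimension.
Variables (K : fieldType) (N : nat).

Definition meval_row (p : {mpoly K[N]}) (x : 'rV[K]_N) : K :=
  p.@[fun i => x 0 i].

(* A subset of the projective space P(K^N) is given by a predicate on vectors
   of homogeneous coordinates.  It need not be closed under scaling, since
   only ratios of forms of equal degree are evaluated on it. *)
Definition projective_space (x : 'rV[K]_N) : Prop := x != 0.

(* There are m algebraically independent rational functions on S.  They are
   written g_i / h with a common denominator h, all forms of one degree; a
   polynomial relation P(g_1 / h, ..., g_m / h) = 0 holds on S when it holds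
   at every point of S where h does not vanish. *)
Definition has_indep_functions (S : 'rV[K]_N -> Prop) (m : nat) : Prop :=
  exists (k : nat) (h : {mpoly K[N]}) (g : 'I_m -> {mpoly K[N]}),
    [/\ h \is k.-homog,
        (forall i, g i \is k.-homog) &
        forall P : {mpoly K[m]}, P != 0 ->
          exists x : 'rV[K]_N,
            [/\ S x, meval_row h x != 0 &
                P.@[fun i => meval_row (g i) x / meval_row h x] != 0]].

(* The dimension of the Zariski closure of S in P(K^N), as the transcendence
   degree over K of its field of rational functions.  (When the closure is
   reducible, this is the largest dimension of a component.) *)
Definition proj_dim (S : 'rV[K]_N -> Prop) (m : nat) : Prop :=
  has_indep_functions S m /\
  forall m', has_indep_functions S m' -> (m' <= m)%N.

End ProjectiveDimension.

Section RationalMap.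
Variables (K : fieldType) (M N : nat).

(* phi is a map on homogeneous coordinates; the rational map it induces is
   defined at the points of the source where phi does not vanish. *)
Definition rational_image (S : 'rV[K]_M -> Prop) (phi : 'rV[K]_M -> 'rV[K]_N)
    (y : 'rV[K]_N) : Prop :=
  exists x : 'rV[K]_M, [/\ S x, phi x != 0 & y = phi x].

Definition maximal_rank (S : 'rV[K]_M -> Prop) (T : 'rV[K]_N -> Prop)
    (phi : 'rV[K]_M -> 'rV[K]_N) : Prop :=
  exists a b : nat,
    [/\ proj_dim S a, proj_dim T b &
        proj_dim (rational_image S phi) (minn a b)].

End RationalMap.

Section CurveSections.
Variable K : fieldType.

Definition smooth_hypersurface (n d : nat) (F : {mpoly K[n.+1]}) : Prop :=
  [/\ F != 0, F \is d.-homog &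
      forall x : 'rV[K]_n.+1, x != 0 -> meval_row F x = 0 ->
        exists i : 'I_n.+1, meval_row F^`M(i) x != 0].

Definition binary_monomial (D : nat) (j : 'I_D.+1) : 'X_{1..2} :=
  [multinom (if i == ord0 then j : nat else (D - j)%N) | i < 2].

Definition binary_form (D : nat) (c : 'rV[K]_D.+1) : {mpoly K[2]} :=
  \sum_(j < D.+1) c 0 j *: 'X_[binary_monomial j].

Definition binary_coeffs (D : nat) (p : {mpoly K[2]}) : 'rV[K]_D.+1 :=
  \row_(j < D.+1) p@_(binary_monomial j).

(* An (n+1)-tuple of binary forms of degree e is the matrix of their
   coefficients, one row per form, flattened by mxvec. *)
Definition forms (n e : nat) (v : 'rV[K]_(n.+1 * e.+1)) :
    n.+1.-tuple {mpoly K[2]} :=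
  [tuple binary_form (row i (vec_mx v)) | i < n.+1].

Definition Mor (n e : nat) (v : 'rV[K]_(n.+1 * e.+1)) : Prop :=
  forall s : 'rV[K]_2, s != 0 ->
    exists i : 'I_n.+1, meval_row (tnth (forms v) i) s != 0.

Definition Phi (n e d : nat) (F : {mpoly K[n.+1]})
    (v : 'rV[K]_(n.+1 * e.+1)) : 'rV[K]_(e * d).+1 :=
  binary_coeffs (e * d) (F \mPo forms v).

Definition curve_sections_vary_maximally (n e d : nat)
    (F : {mpoly K[n.+1]}) : Prop :=
  maximal_rank (@Mor n e) (@projective_space K (e * d).+1) (@Phi n e d F).

End CurveSections.

(* Main.v *)
(* The differential of [Phi] at a curve [f] sends [g] to the sum of the
   [(dF/dx_j)(f) * g_j], so it suffices that on a generic curve of degree [e] the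
   partial derivatives of [F] have no syzygy of degree [e] in the parameter.
   As in the theorem of Grauert and Muelich, a syzygy can be differentiated along
   the vector fields on pairs (curve, parameter) that fix the point of the curve:
   this raises its degree by at most one.  Hence a chain of independent syzygies
   of degrees [e, e + 1, ...] that cannot be prolonged spans a space preserved by
   these fields; being defined over the function field of projective space, its
   Pluecker coordinates, made primitive, are polynomials in the point of the
   curve.  There are [r <= n] syzygies in the chain, so these polynomials have
   degree at most [(r * e + r * (r - 1) / 2) / e < d - 1].  But they are syzygies
   of the partial derivatives, which form a regular sequence of forms of degree
   [d - 1], so they vanish: contradiction. *)

From HB Require Import structures.
Require Import Defs.
From mathcomp Require Import all_boot all_order all_algebra.
From mathcomp Require Import generic_quotient mxred spectral.
From mathcomp Require Import ring zify boolp.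
From mathcomp Require Import mpoly complex reals.

Set Implicit Arguments.
Unset Strict Implicit.
Unset Printing Implicit Defensive.

Import Order.TTheory GRing.Theory Num.Theory.
Local Open Scope ring_scope.

(** * Unique factorization in polynomial rings *)

(** The vector fields need not annihilate the Pluecker coordinates of the span: they multiply all of
    them by one common scalar, a trace. Ratios of coordinates are therefore constants of the fields,
    and once common factors are removed each coordinate divides its own derivatives; this is why
    unique factorization in [{poly {mpoly K[N]}}] comes first. In coordinates where the point of the
    curve replaces its constant coefficients, suitable combinations of the fields are partial
    derivatives, and a polynomial dividing its own partial derivative has derivative zero, for
    degree reasons. So the common scalar disappears and no denominator has to be controlled.

    The numerical hypothesis is n e + n (n - 1) / 2 < e (d - 1) rearranged; the left side bounds the
    degree of the coordinates in the worst case r = n. It also makes the source of [Phi] no larger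
    than its target, so maximal rank follows from injectivity of the differential: in characteristic
    zero, this gives as many algebraically independent coefficients of the section as the curve has
    coefficients. *)

Section Divisibility.
Variable A : idomainType.
Implicit Types a b c p : A.

Definition divides a b := exists c, b = c * a.

Lemma divides0 a : divides a 0.
Proof. by exists 0; rewrite mul0r. Qed.

Lemma dividesD a b c : divides a b -> divides a c -> divides a (b + c).
Proof. by move=> [x ->] [y ->]; exists (x + y); rewrite mulrDl. Qed.

Lemma divides_mull a b c : divides a b -> divides a (c * b).
Proof. by move=> [x ->]; exists (c * x); rewrite mulrA. Qed.

Lemma divides_mulr a b c : divides a b -> divides a (b * c).
Proof. by rewrite mulrC; apply: divides_mull. Qed.

Lemma dividesN a b : divides a b -> divides a (- b).
Proof. by move=> [x ->]; exists (- x); rewrite mulNr. Qed.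

Lemma divides_sum (I : Type) (r : seq I) (P : pred I) (F : I -> A) a :
  (forall i, P i -> divides a (F i)) -> divides a (\sum_(i <- r | P i) F i).
Proof.
by move=> dvdF; apply: big_ind => //; [apply: divides0 | apply: dividesD].
Qed.

Definition prime_elt p :=
  [/\ p != 0, p \isn't a GRing.unit &
      forall a b, divides p (a * b) -> divides p a \/ divides p b].

Definition ufd := forall a, a != 0 ->
  exists u s, [/\ u \is a GRing.unit, forall p, p \in s -> prime_elt p &
                  a = u * \prod_(p <- s) p].

Definition primitive (I : Type) (w : I -> A) :=
  forall p, prime_elt p -> exists i, ~ divides p (w i).

Lemma not_primitive (I : Type) (w : I -> A) : ~ primitive w ->
  exists2 p, prime_elt p & forall i, divides p (w i).
Proof.
move=> /existsNP[p /not_implyP[pp] /forallNP dvdw].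
by exists p => // i; apply: contrapT.
Qed.

Lemma prime_elt_prod p (s : seq A) : prime_elt p ->
  divides p (\prod_(q <- s) q) -> exists2 q, q \in s & divides p q.
Proof.
move=> [p0 pU pP]; elim: s => [|q s IHs].
  by rewrite big_nil => -[c Ec]; case/negP: pU; apply/unitrP; exists c;
     rewrite [p * c]mulrC -Ec.
rewrite big_cons => /pP[|/IHs[q' q's]]; first by exists q; rewrite ?mem_head.
by exists q' => //; rewrite inE q's orbT.
Qed.

Hypothesis ufdA : ufd.

(** The prime factors of [p] are stripped one at a time: each of them fails to divide some [w i],
    hence divides [z]. *)
Lemma primitive_divides (I : Type) (w : I -> A) p z : primitive w ->
  p != 0 -> (forall i, divides p (w i * z)) -> divides p z.
Proof.
move=> prw /ufdA[u [s [uU ps ->]]].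
elim: s ps z => [|q s IHs] ps z.
  by rewrite big_nil mulr1 => _; exists (z / u); rewrite divrK.
rewrite big_cons => dvdz.
have pq : prime_elt q by apply: ps; rewrite mem_head.
have [i ndvd] := prw q pq.
have [q0 _ qP] := pq.
have [z' Ez] : divides q z.
  case: (qP (w i) z) => //; have [c ->] := dvdz i.
  by exists (c * (u * \prod_(p <- s) p)); ring.
have [p' p's|i'|c Ec] := IHs _ z'.
- by apply: ps; rewrite inE p's orbT.
- have [c Ec] := dvdz i'; exists c; apply: (mulIf q0).
  by rewrite -mulrA -Ez Ec -!mulrA; congr (_ * (_ * _)); rewrite mulrC.
- by exists c; rewrite Ez Ec -!mulrA; congr (_ * (_ * _)); rewrite mulrC.
Qed.

(** Common primes are divided out of the family. Each one occurs, up to a unit, in the factorization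
    of the nonzero entry [w i0], whose length bounds the number of divisions. *)
Lemma primitive_part (I : Type) (w : I -> A) i0 : w i0 != 0 ->
  exists h w', [/\ h != 0, forall i, w i = h * w' i & primitive w'].
Proof.
move=> wi0; have [u [s [uU ps Ew]]] := ufdA wi0.
have [m] := ubnP (size s).
elim: m => // m IHm in w u s wi0 uU ps Ew *; rewrite ltnS => sm.
have [prw|/not_primitive[p pp pw]] := EM (primitive w).
  by exists 1, w; split=> [|i|//]; rewrite ?oner_neq0 ?mul1r.
have [w1 Ew1] := choice pw.
have [q qs [c Eq]] : exists2 q, q \in s & divides p q.
  have [p0 pU pP] := pp; apply: (prime_elt_prod pp).
  case: (pP u (\prod_(q <- s) q)); rewrite -?Ew // => -[c Ec].
  case/negP: pU; apply/unitrP; exists (u^-1 * c).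
  by rewrite [p * _]mulrC -mulrA -Ec mulVr.
have [p0 pU pP] := pp; have [q0 qU qP] := ps q qs.
(* Here [q = c * p] with [p] and [q] prime: if [q] divided [c], then [p] would be invertible, so [q]
   divides [p]. *)
have cU : c \is a GRing.unit.
  have [|[x Ex]|[x Ex]] := qP c p; first by rewrite -Eq; exists 1; rewrite mul1r.
    case/negP: pU; apply/unitrP; exists x; suff Hx: x * p = 1.
      by rewrite [p * x]mulrC Hx.
    have c0: c != 0 by apply: contraNneq q0 => c0; rewrite Eq c0 mul0r.
    by apply: (mulIf c0); rewrite mul1r [RHS]Ex Eq mulrAC mulrA.
  apply/unitrP; exists x; suff Hx: x * c = 1 by rewrite [c * x]mulrC Hx.
  by apply: (mulIf p0); rewrite mul1r [RHS]Ex Eq mulrA.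
have [||p' /mem_rem /ps //|||h [w' [h0 Ew' prw']]] := IHm w1 (u * c) (rem q s).
- by apply: contraNneq wi0 => Z; rewrite Ew1 Z mul0r.
- by rewrite unitrM uU.
- apply: (mulIf p0); rewrite -Ew1 Ew (perm_big _ (perm_to_rem qs)) big_cons.
  by rewrite /= Eq -!mulrA; congr (_ * (_ * _)); rewrite mulrC.
- by apply: leq_trans sm; rewrite size_rem // prednK //; case: (s) qs.
exists (p * h), w'; split=> //; first by rewrite mulf_neq0.
by move=> i; rewrite Ew1 Ew' mulrC mulrA.
Qed.

End Divisibility.

Section PolyFactorial.
Variable A : idomainType.
Implicit Types f g h : {poly A}.

Lemma divides_polyC (p : A) f :
  divides p%:P f <-> forall i, divides p f`_i.
Proof.
split=> [[g ->] i|/choice[c Ec]]; first by exists g`_i; rewrite coefMC.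
exists (\poly_(i < size f) c i); apply/polyP=> i; rewrite coefMC coef_poly.
by case: ltnP => [_|sf]; [exact: Ec | rewrite mul0r nth_default].
Qed.

(* The product of the lowest coefficients of [f] and [g] not divisible by [p]
   is, modulo [p], a coefficient of [f * g]. *)
Lemma prime_elt_polyC (p : A) : prime_elt p -> prime_elt (p%:P).
Proof.
move=> [p0 pU pP]; split; first by rewrite polyC_eq0.
  by rewrite poly_unitE coefC eqxx (negbTE pU) andbF.
move=> f g /divides_polyC dvdfg; apply: contrapT => /not_orP[].
move=> /divides_polyC/existsNP[i0 ni0] /divides_polyC/existsNP[j0 nj0].
have [|i /asboolP ni mini] := @ex_minnP (fun i => `[< ~ divides p f`_i >]).
  by exists i0; apply/asboolP.
have [|j /asboolP nj minj] := @ex_minnP (fun j => `[< ~ divides p g`_j >]).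
  by exists j0; apply/asboolP.
have lti : (i < (i + j).+1)%N by rewrite ltnS leq_addr.
have [] := pP f`_i g`_j => //.
have := dvdfg (i + j)%N; rewrite coefM (bigD1 (Ordinal lti)) //= addKn => dvd1.
suff dvd2 : divides p (\sum_(k < (i + j).+1 | k != Ordinal lti)
    f`_k * g`_(i + j - k)).
  have := dividesD dvd1 (dividesN dvd2).
  by rewrite addrK.
apply: divides_sum => k; rewrite -val_eqE /=.
rewrite neq_ltn => /orP[ltki|ltik].
  apply: divides_mulr; apply: contrapT => nk.
  by move: ltki; rewrite ltnNge mini //; apply/asboolP.
apply: divides_mull; apply: contrapT => nk.
have: (j <= i + j - k)%N by apply: minj; apply/asboolP.
by rewrite leqNgt ltn_subLR ?ltn_add2r ?ltik // -ltnS.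
Qed.

Hypothesis ufdA : ufd A.

Lemma poly_primitive_part f : f != 0 ->
  exists c g, [/\ c != 0, f = c%:P * g & primitive (fun i => g`_i)].
Proof.
move=> f0; have lf : f`_(size f).-1 != 0 by rewrite -lead_coefE lead_coef_eq0.
have [c [w [c0 Ew prw]]] := @primitive_part _ ufdA _ (fun i => f`_i) _ lf.
have Eg i : (\poly_(i < size f) w i)`_i = w i.
  rewrite coef_poly; case: ltnP => // sf; apply: (mulfI c0).
  by rewrite -Ew mulr0 nth_default.
exists c, (\poly_(i < size f) w i); split=> //.
  by apply/polyP=> i; rewrite coefCM Eg Ew.
by move=> p /prw[k]; exists k; rewrite Eg.
Qed.

(** Over a domain [%|] only means divisibility up to a nonzero constant, as over the fraction field.
    By Gauss's lemma each prime of that constant divides the quotient, since it cannot divide the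
    primitive [h]. *)
Lemma primitive_divp h f : primitive (fun i => h`_i) -> h %| f -> divides h f.
Proof.
move=> prh /Pdiv.Idomain.dvdpP[[c k] /= c0]; rewrite -mul_polyC => Ef.
have [u [s [uU ps Ec]]] := ufdA c0.
have {Ef} Ef : (\prod_(p <- s) p)%:P * f = (u^-1%:P * k) * h.
  by rewrite -mulrA -Ef mulrA -polyCM Ec mulKr.
elim: s ps (_ * k) Ef {Ec} => [|p s IHs] ps {}k.
  by rewrite big_nil mul1r => Ef; exists k.
rewrite big_cons polyCM -mulrA => Ef.
have pp : prime_elt p by apply: ps; rewrite mem_head.
have [_ _ /(_ k h) pP] := prime_elt_polyC pp.
have [|[k' Ek]|/divides_polyC dvdh] := pP.
- by exists ((\prod_(p <- s) p)%:P * f); rewrite -Ef mulrC.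
- apply: (IHs _ k') => [p' p's|]; first by apply: ps; rewrite inE p's orbT.
  have [p0 _ _] := pp; apply: (@mulfI _ p%:P); rewrite ?polyC_eq0 //.
  by rewrite Ef Ek; ring.
- by have [k1] := prh p pp; case.
Qed.

Lemma prime_elt_irreducible h :
  primitive (fun i => h`_i) -> irreducible_poly h -> prime_elt h.
Proof.
move=> prh irh; split; first exact: irredp_neq0.
  rewrite poly_unitE negb_and; apply/orP; left.
  by case: irh => sh _; rewrite neq_ltn sh orbT.
move=> f g [k Ek]; have [dvdf|ndvd] := boolP (h %| f).
  by left; apply: primitive_divp.
right; apply: primitive_divp => //.
rewrite -(Pdiv.Idomain.Gauss_dvdpr g (q := f)) ?Ek ?dvdp_mulIr //.
apply/Pdiv.Idomain.coprimepP => d dh df.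
have [sd|sd] := eqVneq (size d) 1%N; first by rewrite -size_poly_eq1 sd.
by case/negP: ndvd; rewrite -(eqp_dvdl _ (irh.2 _ sd dh)).
Qed.

Lemma exists_irreducible f : (1 < size f)%N ->
  exists2 h, irreducible_poly h & h %| f.
Proof.
move=> sf; pose P m := `[< exists h, [/\ size h = m, (1 < m)%N & h %| f] >].
have [|m /asboolP[h [sh m1 dvdh]] minm] := @ex_minnP P.
  by exists (size f); apply/asboolP; exists f.
have h0 : h != 0 by rewrite -size_poly_gt0 sh ltnW.
exists h => //; split=> [|q sq dvdq]; first by rewrite sh.
rewrite -dvdp_size_eqp // eqn_leq dvdp_leq //= sh.
apply: minm; apply/asboolP; exists q; split=> //; last exact: dvdp_trans dvdh.
rewrite ltn_neqAle eq_sym sq size_poly_gt0; apply: contraTneq dvdq => ->.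
by rewrite dvd0p.
Qed.

(** The content is factored in [A]; from the primitive part an irreducible primitive factor is split
    off, which lowers the degree. *)
Lemma ufd_poly : ufd {poly A}.
Proof.
move=> f; have [m] := ubnP (size f); elim: m => // m IHm in f *.
rewrite ltnS => sf f0; have [c [g [c0 Ef prg]]] := poly_primitive_part f0.
have g0 : g != 0 by apply: contraNneq f0 => g0; rewrite Ef g0 mulr0.
have Esg : size f = size g by rewrite Ef mul_polyC size_scale.
suff [u [s [uU ps Eg]]] : exists u s, [/\ u \is a GRing.unit,
    forall p, p \in s -> prime_elt p & g = u * \prod_(p <- s) p].
  have [v [t [vU pt Ec]]] := ufdA c0.
  exists (v%:P * u), ([seq p%:P | p <- t] ++ s); split.
  - by rewrite unitrM uU rmorph_unit.
  - move=> p; rewrite mem_cat => /orP[/mapP[q qt ->]|/ps//].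
    by apply: prime_elt_polyC; apply: pt.
  - rewrite big_cat big_map -rmorph_prod /= Ef Eg Ec polyCM; ring.
have [sg|sg] := leqP (size g) 1.
  exists g, [::]; split=> //; last by rewrite big_nil mulr1.
  rewrite (size1_polyC sg); set a := g`_0.
  have a0 : a != 0.
    by apply: contraNneq g0 => a0; rewrite (size1_polyC sg) -/a a0.
  have [v [t [vU pt Ea]]] := ufdA a0.
  (* A prime factor of the constant [a] would divide every coefficient of the primitive [g], so [g]
     is a unit. *)
  case: t pt Ea => [|p t] pt Ea.
    by rewrite Ea big_nil mulr1 rmorph_unit.
  have [|i []] := prg p; first by apply: pt; rewrite mem_head.
  rewrite (size1_polyC sg) coefC; case: eqP => _; last exact: divides0.
  by rewrite -/a Ea big_cons; exists (v * \prod_(q <- t) q); ring.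
have [h0 irh0 dvdh0] := exists_irreducible sg.
have [b [h [b0 Eh prh]]] := poly_primitive_part (irredp_neq0 irh0).
have hh0 : h0 %= h by rewrite Eh mul_polyC eqp_scale.
have irh : irreducible_poly h.
  split=> [|q sq]; first by rewrite -(eqp_size hh0); case: irh0.
  rewrite -(eqp_dvdr _ hh0) => /(irh0.2 _ sq) /eqp_trans; exact.
have [k Ek] : divides h g.
  by apply: primitive_divp => //; rewrite -(eqp_dvdl _ hh0).
have k0 : k != 0 by apply: contraNneq g0 => k0; rewrite Ek k0 mul0r.
have sk : (size k < m)%N.
  apply: leq_trans sf; rewrite Esg Ek size_mul //; last exact: irredp_neq0.
  by case: irh => + _; case: (size h) => [|[|l]] // _; rewrite !addnS ltnS leq_addr.
have [u [s [uU ps Ek']]] := IHm k sk k0.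
exists u, (h :: s); split=> //; last by rewrite Ek Ek' big_cons; ring.
by move=> p; rewrite inE => /predU1P[->|/ps//]; apply: prime_elt_irreducible.
Qed.

End PolyFactorial.

Lemma ufd_bij (A A' : idomainType) (phi : {rmorphism A -> A'}) (psi : A' -> A) :
  cancel phi psi -> cancel psi phi -> ufd A -> ufd A'.
Proof.
move=> phiK psiK ufdA a a0.
have b0 : psi a != 0 by apply: contraNneq a0 => b0; rewrite -[a]psiK b0 rmorph0.
have [u [s [uU ps Eb]]] := ufdA _ b0.
exists (phi u), (map phi s); split; first exact: rmorph_unit.
  move=> _ /mapP[p /ps[p0 pU pP] ->]; split.
  - by apply: contraNneq p0 => p0; rewrite -[p]phiK p0 -(rmorph0 phi) phiK.
  - apply: contra pU => /unitrP[x [Hx _]]; apply/unitrP; exists (psi x).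
    have: psi x * p = 1 by rewrite -[LHS]phiK rmorphM psiK Hx -(rmorph1 phi) phiK.
    by move=> E; rewrite mulrC; split=> //; rewrite mulrC.
  - move=> x y [z Ez]; have := pP (psi x) (psi y).
    case=> [|[t Et]|[t Et]].
    + by exists (psi z); rewrite -[LHS]phiK rmorphM !psiK Ez -{1}[z]psiK
         -rmorphM phiK.
    + by left; exists (phi t); rewrite -rmorphM -Et psiK.
    + by right; exists (phi t); rewrite -rmorphM -Et psiK.
by rewrite big_map -rmorph_prod -rmorphM -Eb psiK.
Qed.

Section MpolyFactorial.
Variable (K : idomainType) (n : nat).

Definition mpoly_of_poly (p : {poly {mpoly K[n]}}) : {mpoly K[n.+1]} :=
  (map_poly (@mwiden n K) p).['X_ord_max].

Lemma mpoly_of_poly_is_additive : additive mpoly_of_poly.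
Proof. by move=> p q; rewrite /mpoly_of_poly rmorphB /= hornerD hornerN. Qed.

Lemma mpoly_of_poly_is_multiplicative : multiplicative mpoly_of_poly.
Proof.
by split=> [p q|]; rewrite /mpoly_of_poly ?rmorphM ?rmorph1 ?hornerM ?hornerC.
Qed.

HB.instance Definition _ := GRing.isAdditive.Build _ _ mpoly_of_poly
  mpoly_of_poly_is_additive.
HB.instance Definition _ := GRing.isMultiplicative.Build _ _ mpoly_of_poly
  mpoly_of_poly_is_multiplicative.

Lemma muni_mwiden (c : {mpoly K[n]}) : muni (mwiden c) = c%:P.
Proof.
elim/mpolyind: c => [|a m c _ _ IHc].
  by rewrite (rmorph0 (@mwiden n K)) (rmorph0 (@muni n K)) polyC0.
rewrite (rmorphD (@mwiden n K)) (rmorphD (@muni n K)) /= IHc polyCD.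
congr (_ + _).
rewrite mwidenZ mwidenX muniZ muniE msuppX big_seq1 mcoeffX eqxx scale1r.
rewrite mnmwiden_ordmax expr0 -mul_polyC (_ : [multinom _ | _ < _] = m).
  by rewrite -mul_mpolyC polyCM -[_ *: 1]mul_polyC mulr1.
by apply/mnmP => i; rewrite mnmE mnmwiden_widen.
Qed.

Lemma muni_Xmax : muni ('X_ord_max : {mpoly K[n.+1]}) = 'X.
Proof.
rewrite muniE msuppX big_seq1 mcoeffX eqxx scale1r mnm1E eqxx expr1.
rewrite (_ : [multinom _ | _ < _] = 0%MM) ?mpolyX0 ?scale1r //.
apply/mnmP => i; rewrite mnmE mnm1E mnm0E -val_eqE /=.
by rewrite gtn_eqF.
Qed.

Lemma mpoly_of_polyK : cancel mpoly_of_poly (@muni n K).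
Proof.
move=> p; rewrite /mpoly_of_poly; elim/poly_ind: p => [|p c IHp].
  by rewrite rmorph0 horner0 (rmorph0 (@muni n K)).
rewrite rmorphD rmorphM /= map_polyX map_polyC hornerD hornerM hornerX hornerC.
rewrite (rmorphD (@muni n K)) (rmorphM (@muni n K)) /= IHp muni_Xmax.
by rewrite muni_mwiden.
Qed.

Lemma mpoly_of_polyD : {morph mpoly_of_poly : p q / p + q}.
Proof. exact: rmorphD. Qed.

Lemma mpoly_of_polyM : {morph mpoly_of_poly : p q / p * q}.
Proof. exact: rmorphM. Qed.

Lemma muniK : cancel (@muni n K) mpoly_of_poly.
Proof.
move=> p; elim/mpolyind: p => [|a m c _ _ IHc].
  by rewrite muni0 /mpoly_of_poly map_poly0 horner0.
rewrite muniD mpoly_of_polyD [X in _ + X]IHc; congr (_ + _).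
rewrite muniZ -mul_polyC muniE msuppX big_seq1 mcoeffX eqxx scale1r.
rewrite -mul_polyC !mpoly_of_polyM /mpoly_of_poly !map_polyC !hornerC /=.
rewrite map_polyXn hornerXn mwidenC mwidenX -mul_mpolyC; congr (_ * _).
rewrite mpolyXn -mpolyXD; congr 'X_[_]; apply/mnmP => i.
rewrite mnmDE mulmnE mnm1E; have [->|ni] := eqVneq i ord_max.
  by rewrite mnmwiden_ordmax mul1n.
rewrite mul0n addn0.
have lti : (i < n)%N.
  by have := ltn_ord i; rewrite ltnS leq_eqVlt => /predU1P[Ei|//];
     case/eqP: ni; apply: val_inj.
have -> : i = widen_ord (leqnSn n) (Ordinal lti) by apply: val_inj.
by rewrite mnmwiden_widen mnmE.
Qed.

End MpolyFactorial.

Lemma ufd_mpoly (K : fieldType) n : ufd {mpoly K[n]}.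
Proof.
elim: n => [|n IHn]; last first.
  apply: (@ufd_bij _ _ (@mpoly_of_poly K n) (@muni n K)).
  - exact: mpoly_of_polyK.
  - exact: muniK.
  - exact: ufd_poly.
move=> a a0; exists a, [::]; split=> //; last by rewrite big_nil mulr1.
rewrite -[a]mpolyKC rmorph_unit // unitfE.
by apply: contraNneq a0 => a0; rewrite -[a]mpolyKC a0 mpolyC0.
Qed.

(** * Syzygies of forms without common zero *)

Section Graded.
Variables (K : numFieldType) (N : nat).
Local Notation S := {mpoly K[N]}.
Implicit Types (p : S).

(* Forms of degree [q - d], the zero form alone when [q < d]. *)
Definition twisted (d q : nat) (h : S) : bool :=
  if (d <= q)%N then h \is (q - d).-homog else h == 0.

Lemma twisted0 d q : twisted d q 0.
Proof. by rewrite /twisted; case: ifP; rewrite ?rpred0 ?eqxx. Qed.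

Lemma twistedD d q p (h : S) :
  twisted d q p -> twisted d q h -> twisted d q (p + h).
Proof.
rewrite /twisted; case: ifP => _; first exact: rpredD.
by move=> /eqP-> /eqP->; rewrite addr0.
Qed.

Lemma twistedZ d q c p : twisted d q p -> twisted d q (c *: p).
Proof.
rewrite /twisted; case: ifP => _; first exact: rpredZ.
by move=> /eqP->; rewrite scaler0.
Qed.

Lemma twistedN d q p : twisted d q p -> twisted d q (- p).
Proof. by rewrite -scaleN1r; apply: twistedZ. Qed.

Lemma twistedB d q p (h : S) :
  twisted d q p -> twisted d q h -> twisted d q (p - h).
Proof. by move=> tp th; rewrite twistedD // twistedN. Qed.

Lemma twistedMl d e q p (h : S) :
  twisted (d + e) q p -> h \is e.-homog -> twisted d q (h * p).
Proof.
move=> tp th; have [qde|deq] := ltnP q (d + e).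
  move: tp; rewrite /twisted leqNgt qde => /eqP ->; rewrite mulr0.
  exact: twisted0.
have eqd : (e <= q - d)%N by rewrite leq_subRL // (leq_trans (leq_addr e d)).
move: tp; rewrite /twisted deq (leq_trans (leq_addr e d) deq) => tp.
by rewrite -(subnKC eqd) dhomogM // -subnDA.
Qed.

Definition twist_part (d q : nat) (h : S) : S :=
  if (d <= q)%N then pihomog mdeg (q - d) h else 0.

Lemma twist_partP d q h : twisted d q (twist_part d q h).
Proof.
by rewrite /twisted /twist_part; case: leqP => _; [exact: pihomogP | exact: eqxx].
Qed.

Lemma pihomogM d q (h : S) p : p \is d.-homog ->
  pihomog mdeg q (h * p) = twist_part d q h * p.
Proof.
move=> hp; rewrite [in LHS](pihomog_partitionE (leqnn (mmeasure mdeg h))).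
set M := mmeasure _ _; rewrite mulr_suml raddf_sum /=.
rewrite /twist_part; case: ifP => dq; last first.
  rewrite mul0r big1 // => k _; apply: (pihomog_ne0 (d := (k + d)%N)).
    by apply: contraFneq dq => <-; rewrite leq_addl.
  by rewrite dhomogM ?pihomogP.
have [ltM|leM] := ltnP (q - d) M; last first.
  rewrite big1 => [|k _].
    rewrite pihomogE big_seq_cond big1 ?mul0r // => m /andP[mh /eqP Em].
    have : (mdeg m < M)%N by apply: mmeasure_mnm_lt.
    by rewrite ltnNge Em leM.
  apply: (pihomog_ne0 (d := (k + d)%N)); last by rewrite dhomogM ?pihomogP.
  have: (k < q - d)%N by apply: leq_trans leM.
  by apply: contraTneq => <-; rewrite addnK ltnn.
rewrite (bigD1 (Ordinal ltM)) //= big1 ?addr0 => [|k nk].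
  by apply: pihomog_dE; rewrite -{2}(subnK dq) dhomogM ?pihomogP.
apply: (pihomog_ne0 (d := (k + d)%N)); last by rewrite dhomogM ?pihomogP.
by apply: contraNneq nk => Ek; apply/eqP/val_inj; rewrite /= -Ek addnK.
Qed.

Definition in_ideal (I : finType) (P : {set I}) (a : I -> S) (u : S) :=
  exists h, u = \sum_(i in P) h i * a i.

Section Ideal.
Variables (I : finType) (P : {set I}) (a : I -> S) (da : I -> nat).

Lemma in_ideal0 : in_ideal P a 0.
Proof. by exists (fun=> 0); rewrite big1 // => i _; rewrite mul0r. Qed.

Lemma in_idealD u v : in_ideal P a u -> in_ideal P a v -> in_ideal P a (u + v).
Proof.
move=> [h ->] [k ->]; exists (fun i => h i + k i).
by rewrite -big_split; apply: eq_bigr => i _; rewrite mulrDl.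
Qed.

Lemma in_idealM u v : in_ideal P a v -> in_ideal P a (u * v).
Proof.
move=> [h ->]; exists (fun i => u * h i).
by rewrite mulr_sumr; apply: eq_bigr => i _; rewrite mulrA.
Qed.

Lemma in_idealN u : in_ideal P a u -> in_ideal P a (- u).
Proof. by rewrite -mulN1r; apply: in_idealM. Qed.

Lemma in_idealB u v : in_ideal P a u -> in_ideal P a v -> in_ideal P a (u - v).
Proof. by move=> Iu Iv; apply: in_idealD => //; apply: in_idealN. Qed.

Lemma in_idealZ c u : in_ideal P a u -> in_ideal P a (c *: u).
Proof. by rewrite -mul_mpolyC; apply: in_idealM. Qed.

Lemma in_ideal_sum (J : Type) (r : seq J) (Q : pred J) (F : J -> S) :
  (forall j, Q j -> in_ideal P a (F j)) ->
  in_ideal P a (\sum_(j <- r | Q j) F j).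
Proof.
by move=> IF; apply: big_ind => //; [exact: in_ideal0 | exact: in_idealD].
Qed.

Hypothesis ha : forall i, a i \is (da i).-homog.

Lemma in_ideal_pihomog q u :
  in_ideal P a u -> in_ideal P a (pihomog mdeg q u).
Proof.
move=> [h ->]; exists (fun i => twist_part (da i) q (h i)).
by rewrite raddf_sum; apply: eq_bigr => i _ /=; rewrite (pihomogM q _ (ha i)).
Qed.

(* Vanishing of the first Koszul homology of the family [a] restricted to [P]. *)
Definition koszul1 (P : {set I}) (a : I -> S) (da : I -> nat) :=
  forall q h, (forall i, twisted (da i) q (h i)) ->
  \sum_(i in P) h i * a i = 0 ->
  exists s : I -> I -> S, [/\ forall i j, s i j = - s j i,
    forall i j, twisted (da i + da j) q (s i j) &
    forall i, i \in P -> h i = \sum_(j in P) s i j * a j].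

Lemma antisym_diag (s : I -> I -> S) :
  (forall i j, s i j = - s j i) -> forall i, s i i = 0.
Proof.
move=> sN i; apply/eqP; have /eqP := sN i i; rewrite -addr_eq0 -mulr2n.
by rewrite -scaler_nat scaler_eq0 pnatr_eq0.
Qed.

Definition nonzerodivisor_mod (P : {set I}) (a : I -> S) (c : S) :=
  forall q u, u \is q.-homog -> in_ideal P a (c * u) -> in_ideal P a u.

(** A relation expressing [a i0 * u] by the other generators is a syzygy with entry [- u] at [i0].
    Its potential is antisymmetric, so [a i0] does not enter the resulting expression of [u]. *)
Lemma koszul1_nonzerodivisor i0 : i0 \in P -> koszul1 P a da ->
  nonzerodivisor_mod (P :\ i0) a (a i0).
Proof.
move=> Pi0 kos q u hu Iu.
have hbu : a i0 * u \is (da i0 + q).-homog by rewrite dhomogM.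
case: Iu => k Ek.
pose h i := if i == i0 then - u else twist_part (da i) (da i0 + q) (k i).
have [||s [sN ts sE]] := kos (da i0 + q)%N h.
- move=> i; rewrite /h; case: eqP => [->|_]; last exact: twist_partP.
  by rewrite twistedN // /twisted leq_addr addKn.
- rewrite (big_setD1 i0) //= /h eqxx mulNr [u * _]mulrC -(pihomog_dE hbu) Ek.
  rewrite (raddf_sum (pihomog mdeg _)) -sumrN -big_split big1 //= => i.
  rewrite !inE => /andP[/negPf -> _].
  by rewrite (pihomogM _ _ (ha i)) addrC subrr.
exists (fun j => - s i0 j); rewrite -[LHS]opprK.
have := sE i0 Pi0; rewrite {1}/h eqxx => ->.
rewrite (big_setD1 i0) //= antisym_diag // mul0r add0r -sumrN.
by apply: eq_bigr => i _; rewrite mulNr.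
Qed.

(** Graded Nakayama: extend a syzygy of the smaller family by zero at [i0]. Row [i0] of its
    potential [s] is again a syzygy, in a degree lower by [da i0 > 0], so by induction it has a
    potential [t], and [s - a i0 * t] is the potential wanted. *)
Lemma koszul1D1 i0 : i0 \in P -> (0 < da i0)%N -> koszul1 P a da ->
  koszul1 (P :\ i0) a da.
Proof.
move=> Pi0 d0 kos q; have [m] := ubnP q; elim: m => // m IHm in q *.
rewrite ltnS => qm h th h0.
pose h' i := if i == i0 then 0 else h i.
have [||s [sN ts sE]] := kos q h'.
- by move=> i; rewrite /h'; case: eqP => // _; apply: twisted0.
- rewrite (big_setD1 i0) //= /h' eqxx mul0r add0r -[RHS]h0; apply: eq_bigr => i.
  by rewrite !inE => /andP[/negPf ->].
have s0 : \sum_(j in P :\ i0) s i0 j * a j = 0.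
  have := sE i0 Pi0; rewrite /h' eqxx (big_setD1 i0) //= antisym_diag //.
  by rewrite mul0r add0r.
have [t [tN tt tE]] : exists t : I -> I -> S, [/\ forall i j, t i j = - t j i,
    forall i j, twisted (da i + da j + da i0) q (t i j) &
    forall i, i \in P :\ i0 -> s i0 i = \sum_(j in P :\ i0) t i j * a j].
  have [dq|qd] := leqP (da i0) q; last first.
    exists (fun _ _ => 0); split=> [i j|i j|i _]; rewrite ?oppr0 ?twisted0 //.
    rewrite big1 => [|j _]; last by rewrite mul0r.
    apply/eqP; move: (ts i0 i); rewrite /twisted leqNgt.
    by rewrite (leq_trans qd) ?leq_addr.
  have [|i|//|t [tN tt tE]] := IHm (q - da i0)%N _ (s i0).
  - by apply: leq_trans qm; rewrite ltn_subrL d0 (leq_trans d0).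
  - move: (ts i0 i); rewrite /twisted addnC leq_subRL // addnC.
    by rewrite [(da i0 + _)%N]addnC; case: ifP; rewrite // addnC subnDA.
  - exists t; split=> // i j; move: (tt i j).
    by rewrite /twisted leq_subRL // addnC -subnDA [(da i0 + _)%N]addnC.
exists (fun i j => s i j - a i0 * t i j); split=> [i j|i j|i iP].
- by rewrite sN tN; ring.
- by apply: twistedB => //; apply: twistedMl (ha i0).
have [ni0 Pi] : i != i0 /\ i \in P by move: iP; rewrite !inE => /andP.
have := sE i Pi; rewrite /h' (negPf ni0) => ->.
rewrite (big_setD1 i0) //= sN (tE i) // mulNr mulr_suml -sumrN -big_split /=.
by apply: eq_bigr => j _; rewrite mulrBl addrC; ring.
Qed.

(** Since [a i0] is a nonzerodivisor modulo the others, the entry [h i0] is a combination of them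
    with coefficients [u i]. Adding the corresponding Koszul relations leaves a syzygy of the
    smaller family. *)
Lemma koszul1U1 i0 : i0 \in P -> nonzerodivisor_mod (P :\ i0) a (a i0) ->
  koszul1 (P :\ i0) a da -> koszul1 P a da.
Proof.
move=> Pi0 nzd kos q h th h0.
have E0 : a i0 * h i0 = - \sum_(i in P :\ i0) h i * a i.
  by apply/eqP; rewrite -addr_eq0 mulrC -(big_setD1 i0) //= h0.
have [u tu Eu] : exists2 u, (forall i, twisted (da i + da i0) q (u i)) &
    h i0 = \sum_(i in P :\ i0) u i * a i.
  have := th i0; rewrite {1}/twisted; case: ifP => [dq hh|dq /eqP ->]; last first.
    exists (fun=> 0) => [i|]; first exact: twisted0.
    by rewrite big1 // => i _; rewrite mul0r.
  have Ih0 : in_ideal (P :\ i0) a (h i0).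
    apply: nzd hh _; rewrite E0; exists (fun i => - h i); rewrite -sumrN.
    by apply: eq_bigr => i _; rewrite mulNr.
  case: Ih0 => u Eu; exists (fun i => twist_part (da i) (q - da i0) (u i)).
    move=> i; have := twist_partP (da i) (q - da i0) (u i); rewrite /twisted.
    by rewrite leq_subRL // addnC -subnDA [(da i0 + _)%N]addnC.
  rewrite -[LHS](pihomog_dE hh) Eu raddf_sum; apply: eq_bigr => i _ /=.
  exact: (pihomogM _ _ (ha i)).
have [||t [tN tt tE]] := kos q (fun i => h i + a i0 * u i).
- by move=> i; apply: twistedD => //; apply: twistedMl (ha i0).
- under eq_bigr => i _ do rewrite mulrDl -mulrA.
  by rewrite big_split /= -mulr_sumr -Eu E0 subrr.
exists (fun i j => if i == i0 then if j == i0 then 0 else u j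
                   else if j == i0 then - u i else t i j).
split=> [i j|i j|i Pi].
- by case: eqP => _; case: eqP => _; rewrite ?oppr0 ?opprK.
- case: eqP => [->|_]; case: eqP => [->|_] //; first exact: twisted0.
    by rewrite addnC.
  by rewrite twistedN.
rewrite (big_setD1 i0) //= eqxx; case: (eqVneq i i0) => [->|ni].
  by rewrite mul0r add0r Eu; apply: eq_bigr => j; rewrite !inE => /andP[/negPf ->].
have iP : i \in P :\ i0 by rewrite !inE ni.
have -> : h i = h i + a i0 * u i + - u i * a i0 by ring.
rewrite tE // addrC; congr (_ + _).
by apply: eq_bigr => j; rewrite !inE => /andP[/negPf ->].
Qed.

(** The entries of a potential would be forms of the negative degree [d - D]. *)
Lemma koszul1_low_degree D d h : (forall i, da i = D) -> (d < D)%N ->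
  koszul1 P a da -> (forall i, h i \is d.-homog) ->
  \sum_(i in P) h i * a i = 0 -> forall i, i \in P -> h i = 0.
Proof.
move=> Eda dD kos hh h0 i Pi.
have [||s [_ ts ->//]] := kos (d + D)%N h.
- by move=> j; rewrite /twisted Eda leq_addl addnK.
- exact: h0.
rewrite big1 // => j _; have := ts i j; rewrite /twisted !Eda leqNgt ltn_add2r dD.
by move=> /eqP ->; rewrite mul0r.
Qed.

End Ideal.

Lemma dhomog_deriv d (h : S) i : h \is d.+1.-homog -> h^`M(i) \is d.-homog.
Proof.
move=> hh; rewrite [h]mpolyE raddf_sum /= big_seq; apply: rpred_sum => m mh.
rewrite mderivZ mderivX scalerA; have [->|mi] := eqVneq (m i) 0%N.
  by rewrite mulr0 scale0r rpred0.
apply: rpredZ; suff : 'X_[m - U_(i)] \is [in K[N], d.-homog] by [].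
rewrite dhomogX /= -(eqn_add2r 1) -{1}(mdeg1 i) -mdegD submK ?lep1mP //.
by rewrite (dhomog_mf hh mh) addn1.
Qed.

Lemma euler d (h : S) : h \is d.-homog ->
  \sum_(i < N) 'X_i * h^`M(i) = d%:R *: h.
Proof.
move=> hh; rewrite {2}[h]mpolyE scaler_sumr /mderiv.
under eq_bigr => i _ do rewrite mulr_sumr.
rewrite exchange_big /= big_seq [RHS]big_seq; apply: eq_bigr => m mh.
rewrite -(dhomog_mf hh mh) /= mdegE natr_sum scaler_suml; apply: eq_bigr => i _.
rewrite -scalerAr -scalerA; have [->|mi] := eqVneq (m i) 0%N.
  by rewrite !scale0r.
by rewrite -mpolyXD addmC submK // lep1mP.
Qed.

(* By Euler's formula the Koszul potential of a syzygy [h] of the variables is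
   proportional to [d h_i / d x_j - d h_j / d x_i]. *)
Lemma koszul1_variables : koszul1 [set: 'I_N] (fun i => 'X_i) (fun=> 1%N).
Proof.
have bigT (G : 'I_N -> S) : \sum_(j in [set: 'I_N]) G j = \sum_(j < N) G j.
  by apply: eq_bigl => j; rewrite inE.
move=> [|q] h th h0.
  exists (fun _ _ => 0); split=> [i j|i j|i _]; rewrite ?oppr0 ?twisted0 //.
  by have := th i; rewrite /twisted ltnn => /eqP ->; rewrite big1 // => j _; rewrite mul0r.
have hh i : h i \is q.-homog by have := th i; rewrite /twisted subn1.
exists (fun i j => (q.+1%:R)^-1 *: ((h i)^`M(j) - (h j)^`M(i))); split.
- by move=> i j; rewrite -scalerN opprB.
- move=> i j; rewrite twistedZ // /twisted addn1 !ltnS; case: ltnP => [q0|].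
    by case: q q0 hh {th} => // q _ hh; rewrite subSS subn1 rpredB // dhomog_deriv.
  rewrite leqn0 => /eqP q0.
  have E k : h k = ((h k)@_0%MM)%:MP.
    apply: msize1_polyC; rewrite msizeE; apply/bigmax_leqP_seq => m mh _.
    by have := hh k; rewrite q0 => hk; rewrite (dhomog_mf hk mh).
  by rewrite [h i]E [h j]E !mderivC subrr.
move=> i _; under eq_bigr => j _ do rewrite -scalerAl.
rewrite -scaler_sumr.
under eq_bigr => j _ do rewrite mulrBl ![_ * 'X_j]mulrC.
rewrite bigT sumrB (euler (hh i)).
suff -> : \sum_(j < N) 'X_j * (h j)^`M(i) = - h i.
  by rewrite opprK -{3}[h i]scale1r -scalerDl -natr1 scalerA mulVf ?scale1r //
     natr1 pnatr_eq0.
apply/eqP; rewrite -addr_eq0; apply/eqP.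
have := congr1 (mderiv i) h0; rewrite mderiv0 bigT raddf_sum /= => E.
rewrite -[RHS]E; under [in RHS]eq_bigr => j _ do rewrite mderivM.
rewrite big_split /=; congr (_ + _).
  by apply: eq_bigr => j _; rewrite mulrC.
rewrite (bigD1 i) //= big1 => [|j ji]; rewrite mderivX mnm1E.
  have -> : (U_(i) - U_(i) = 0)%MM.
    by apply/mnmP => k; rewrite mnmBE subnn mnm0E.
  by rewrite eqxx scale1r mpolyX0 mulr1 addr0.
by rewrite (negPf ji) scale0r mulr0.
Qed.

End Graded.

(** Serves to choose a basis of one graded piece of a quotient; the subspace [J] is only a
    predicate, so no quotient space is formed. *)
Lemma basis_mod (K : fieldType) (V : lmodType K) (J : V -> Prop) (l : seq V) :
  J 0 -> (forall c u v, J u -> J v -> J (c *: u + v)) ->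
  exists r (e : 'I_r -> V), [/\ forall i, e i \in l,
    forall x : 'rV_r, J (\sum_i x 0 i *: e i) -> x = 0 &
    forall v, v \in l -> exists x : 'rV_r, J (v - \sum_i x 0 i *: e i)].
Proof.
move=> J0 JP; elim: l => [|v l [r [e [el ei es]]]].
  exists 0%N, (fun=> 0); split=> [[]|x _|] //; apply/rowP; case=> //.
have [[x Jx]|nJ] := EM (exists x : 'rV_r, J (v - \sum_i x 0 i *: e i)).
  exists r, e; split=> // [i|w]; first by rewrite inE el orbT.
  by rewrite inE => /predU1P[->|/es//]; exists x.
pose e' (i : 'I_r.+1) := oapp e v (unlift ord0 i).
have e'0 : e' ord0 = v by rewrite /e' unlift_none.
have e'S i : e' (lift ord0 i) = e i by rewrite /e' liftK.
have sum_e' (x : 'rV_r.+1) : \sum_i x 0 i *: e' i =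
    x 0 ord0 *: v + \sum_i (\row_i x 0 (lift ord0 i)) 0 i *: e i.
  rewrite big_ord_recl e'0; congr (_ + _); apply: eq_bigr => i _.
  by rewrite e'S mxE.
exists r.+1, e'; split=> [i|x|w].
- by case: (unliftP ord0 i) => [j ->|->]; rewrite ?e'0 ?e'S inE ?eqxx ?el ?orbT.
- rewrite sum_e'; set y := \row_i _ => Jx.
  have [x0|x0] := eqVneq (x 0 ord0) 0.
    have /ei y0 : J (\sum_i y 0 i *: e i) by rewrite x0 scale0r add0r in Jx.
    apply/rowP => i; rewrite mxE; case: (unliftP ord0 i) => [j ->|-> //].
    by have := congr1 (fun z : 'rV_r => z 0 j) y0; rewrite !mxE.
  case: nJ; exists (- (x 0 ord0)^-1 *: y).
  have := JP (x 0 ord0)^-1 _ _ Jx J0.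
  rewrite addr0 scalerDr scalerA mulVf // scale1r scaler_sumr -sumrN.
  congr (J (_ + _)); apply: eq_bigr => i _.
  by rewrite scalerA -scaleNr !mxE mulNr opprK.
- rewrite inE => /predU1P[->|/es[x Jx]].
    exists (\row_i (i == ord0)%:R); rewrite sum_e' !mxE scale1r big1 ?addr0 ?subrr //.
    by move=> i _; rewrite !mxE scale0r.
  exists (\row_i oapp (x 0) 0 (unlift ord0 i)).
  rewrite sum_e' !mxE unlift_none scale0r add0r.
  congr (J (_ - _)): Jx; apply: eq_bigr => i _.
  by rewrite !mxE liftK.
Qed.

Lemma exists_nonroot (K : numDomainType) (p : {poly K}) :
  p != 0 -> exists x, p.[x] != 0.
Proof.
move=> p0; apply: contrapT => /forallNP nex.
pose s : seq K := [seq i%:R | i <- iota 0 (size p)].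
have us : uniq s.
  by rewrite map_inj_uniq ?iota_uniq // => i j /eqP; rewrite eqr_nat => /eqP.
have rs : all (root p) s.
  by apply/allP => x _; apply: contrapT => /negP /nex.
by have := max_poly_roots p0 rs us; rewrite size_map size_iota ltnn.
Qed.

(** Points [(1, x, x ^ 2, ...)] of the moment curve lie on a given hyperplane for finitely many [x]
    only. *)
Lemma avoid_hyperplanes (K : numFieldType) (I : finType) N (w : I -> 'I_N -> K) :
  (forall i, exists j, w i j != 0) ->
  exists c : 'I_N -> K, forall i, \sum_j c j * w i j != 0.
Proof.
move=> nzw; pose p i : {poly K} := \poly_(j < N) oapp (w i) 0 (insub j).
have ew i j : (p i)`_(val j) = w i j by rewrite coef_poly ltn_ord valK.
have p0 : \prod_i p i != 0.
  apply/prodf_neq0 => i _; have [j] := nzw i.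
  by apply: contraNneq => pi0; rewrite -ew pi0 coef0.
have [x] := exists_nonroot p0; rewrite horner_prod => /prodf_neq0 px.
exists (fun j => x ^+ j) => i; have := px i isT; rewrite horner_poly.
by under eq_bigr => j _ do rewrite valK mulrC.
Qed.

(** * Exchanging a variable for a combination of given forms *)

Section Exchange.
Variables (K : numClosedFieldType) (N : nat) (I : finType).
Local Notation S := {mpoly K[N]}.
Variables (P : {set I}) (a : I -> S) (da : I -> nat) (k : 'I_N) (m0 : nat).
Hypothesis ha : forall i, a i \is (da i).-homog.
Hypothesis nzd : nonzerodivisor_mod P a 'X_k.
Local Notation J := (in_ideal P a).
Hypothesis fin : forall m (p : S), (m0 <= m)%N -> p \is m.-homog ->
  exists u, J (p - u * 'X_k).

Let Xhomog (i : 'I_N) : ('X_i : S) \is 1.-homog.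
Proof. by rewrite dhomogX /= mdeg1. Qed.

Let Xnhomog (i : 'I_N) j : ('X_i : S) ^+ j \is j.-homog.
Proof. by have := dhomogMn j (Xhomog i); rewrite mul1n. Qed.

(** With [nzd], this makes multiplication by ['X_k] bijective modulo the ideal from degree [m] to
    degree [m.+1] once [m0 <= m]. Geometrically, the ideal cuts out finitely many points, none on
    the hyperplane ['X_k = 0]. *)
Lemma quotient_divX m (p : S) : (m0 <= m)%N -> p \is m.+1.-homog ->
  exists2 u, u \is m.-homog & J (p - u * 'X_k).
Proof.
move=> lem hp; have [u Ju] := fin (leqW lem) hp.
exists (pihomog mdeg m u); first exact: pihomogP.
have := in_ideal_pihomog ha m.+1 Ju.
by rewrite raddfB /= (pihomogM _ _ (Xhomog k)) pihomog_dE // /twist_part subn1.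
Qed.

Lemma quotient_divXn j m (p : S) : (m0 <= m)%N -> p \is (m + j).-homog ->
  exists2 u, u \is m.-homog & J (p - u * 'X_k ^+ j).
Proof.
move=> lem; elim: j => [|j IHj] in p *.
  rewrite addn0 => hp; exists p => //.
  by rewrite expr0 mulr1 subrr; apply: in_ideal0.
rewrite addnS => /quotient_divX[|v hv Jv]; first by rewrite (leq_trans lem) ?leq_addr.
have [u hu Ju] := IHj v hv; exists u => //.
have -> : p - u * 'X_k ^+ j.+1 = (p - v * 'X_k) + 'X_k * (v - u * 'X_k ^+ j).
  by rewrite exprS; ring.
by apply: in_idealD => //; apply: in_idealM.
Qed.

Lemma quotient_Xn_nzd j q (u : S) : u \is q.-homog -> J ('X_k ^+ j * u) -> J u.
Proof.
move=> hu; elim: j => [|j IHj]; first by rewrite mul1r.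
rewrite exprS -mulrA => Ju; apply: IHj; apply: (nzd (q := (j + q)%N)) => //.
exact: dhomogM.
Qed.

(* The forms of degree [m0] modulo the ideal form a finite-dimensional space,
   on which the ['X_i / 'X_k] act as commuting operators; in a basis making
   them triangular their joint eigenvalues are points with [k]-th coordinate
   [1]. *)
Lemma quotient_operators : exists r (E : 'rV[K]_r -> S) (z : 'I_r -> 'I_N -> K),
  [/\ (forall x, E x \is m0.-homog) /\
      (forall p : S, p \is m0.-homog -> exists x, J (p - E x)),
      forall x, J (E x) -> x = 0,
      forall l, z l k = 1 &
      forall d (p : S), p \is d.-homog -> exists T : 'M[K]_r,
        [/\ is_trig_mx T, forall l, T l l = p.@[z l] &
            forall x, J (p * E x - 'X_k ^+ d * E (x *m T))]].
Proof.
have JZ c (u v : S) : J u -> J v -> J (c *: u + v).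
  by move=> Ju Jv; apply: in_idealD => //; apply: in_idealZ.
pose l : seq S := [seq 'X_[val t] | t <- enum {: 'X_{1..N < m0.+1}} & mdeg (val t) == m0].
have [r [e [el ei es]]] := basis_mod l (in_ideal0 P a) JZ.
have he i : e i \is m0.-homog.
  by have /mapP[t] := el i; rewrite mem_filter => /andP[mt _] ->; rewrite dhomogX.
pose E (x : 'rV[K]_r) := \sum_i x 0 i *: e i.
have hE x : E x \is m0.-homog by apply: rpred_sum => i _; apply: rpredZ.
have EZ c x y : E (c *: x + y) = c *: E x + E y.
  rewrite /E scaler_sumr -big_split; apply: eq_bigr => i _ /=.
  by rewrite !mxE scalerDl scalerA.
have E0 : E 0 = 0 by rewrite /E big1 // => i _; rewrite mxE scale0r.
have EM x (A : 'M_r) : E (x *m A) = \sum_i x 0 i *: E (row i A).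
  rewrite /E; under [RHS]eq_bigr => i _ do rewrite scaler_sumr.
  rewrite exchange_big; apply: eq_bigr => j _ /=.
  by rewrite mxE scaler_suml; apply: eq_bigr => i _; rewrite mxE scalerA.
have spanE p : p \is m0.-homog -> exists x, J (p - E x).
  move=> hp; have /choice[c Jc] : forall t : 'X_{1..N < m0.+1}, exists x,
      J ((p@_t) *: 'X_[t] - E x).
    move=> t; have [mt|mt] := eqVneq (mdeg t) m0; last first.
      exists 0; rewrite (dhomog_nemf_coeff hp mt) scale0r E0 subrr.
      exact: in_ideal0.
    have [|x Jx] := es 'X_[t].
      by apply/mapP; exists t; rewrite // mem_filter mt eqxx mem_enum.
    exists (p@_t *: x); rewrite -[p@_t *: x]addr0 EZ E0 addr0 -scalerBr.
    exact: in_idealZ.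
  exists (\sum_t c t).
  have Esum : E (\sum_t c t) = \sum_t E (c t).
    apply: (big_morph E) => // x y.
    by rewrite -[x]scale1r EZ !scale1r.
  have sp : (msize p <= m0.+1)%N.
    rewrite msizeE; apply/bigmax_leqP_seq => m mp _.
    by rewrite (dhomog_mf hp mp).
  rewrite (mpolywE sp) Esum -sumrB; apply: in_ideal_sum => t _; exact: Jc.
(* [A] is the matrix of the operator [p / 'X_k ^+ d] on the degree [m0] part of the quotient. *)
pose Rel d (p : S) (A : 'M[K]_r) := forall x, J (p * E x - 'X_k ^+ d * E (x *m A)).
have RelM d p A d' p' A' :
    Rel d p A -> Rel d' p' A' -> Rel (d + d')%N (p * p') (A' *m A).
  move=> RA RA' x; rewrite mulmxA.
  have -> : p * p' * E x - 'X_k ^+ (d + d') * E (x *m A' *m A) =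
      p * (p' * E x - 'X_k ^+ d' * E (x *m A')) +
      'X_k ^+ d' * (p * E (x *m A') - 'X_k ^+ d * E (x *m A' *m A)).
    by rewrite exprD; ring.
  by apply: in_idealD; apply: in_idealM.
have Rel_uniq d p A A' : Rel d p A -> Rel d p A' -> A = A'.
  move=> RA RA'; apply/row_matrixP => i; rewrite !rowE; apply/eqP.
  rewrite -subr_eq0; apply/eqP/ei; set x := delta_mx 0 i.
  suff : J (E (x *m A - x *m A')) by [].
  apply: (@quotient_Xn_nzd d m0) => //.
  have -> : E (x *m A - x *m A') = E (x *m A) - E (x *m A').
    by rewrite /E -sumrB; apply: eq_bigr => j _; rewrite !mxE scalerBl.
  have -> : 'X_k ^+ d * (E (x *m A) - E (x *m A')) =
      (p * E x - 'X_k ^+ d * E (x *m A')) - (p * E x - 'X_k ^+ d * E (x *m A)).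
    by ring.
  exact: in_idealB.
have /choice[Th RTh] : forall i, exists A, Rel 1%N 'X_i A.
  move=> i; have /choice[c Jc] : forall j, exists x, J ('X_i * e j - 'X_k * E x).
    move=> j; have [|u hu Ju] := @quotient_divX m0 ('X_i * e j) (leqnn _).
      by rewrite -add1n dhomogM.
    have [x Jx] := spanE u hu; exists x.
    have -> : 'X_i * e j - 'X_k * E x = ('X_i * e j - u * 'X_k) + 'X_k * (u - E x).
      by ring.
    by apply: in_idealD => //; apply: in_idealM.
  exists (\matrix_j c j) => x; rewrite EM expr1 !mulr_sumr -sumrB.
  apply: in_ideal_sum => j _; rewrite rowK -!scalerAr -scalerBr.
  exact: in_idealZ.
have Thk : Th k = 1%:M.
  apply: (Rel_uniq 1%N 'X_k) => // x; rewrite mulmx1 expr1 subrr.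
  exact: in_ideal0.
have Thcomm i j : comm_mx (Th i) (Th j).
  apply: (Rel_uniq 2%N ('X_i * 'X_j)); last exact: (RelM 1%N _ _ 1%N).
  by rewrite mulrC; exact: (RelM 1%N _ _ 1%N).
have [|Q uQ /allP trig] := @cotrigonalization K r [seq Th i | i <- enum 'I_N].
  by move=> _ _ /mapP[i _ ->] /mapP[j _ ->].
have QU : Q \in unitmx := unitarymx_unit uQ.
pose T i := Q *m Th i *m invmx Q.
have Ttrig i : is_trig_mx (T i).
  have := trig (Th i); rewrite map_f ?mem_enum // => /(_ isT).
  by rewrite /= /similar_to conjumx.
pose z (l : 'I_r) i := T i l l.
exists r, (fun x => E (x *m Q)), z; split=> [|x Jx|l0|d p hp].
- split=> // p /spanE[x Jx]; exists (x *m invmx Q).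
  by rewrite mulmxKV.
- by have /(congr1 (mulmxr (invmx Q))) := ei _ Jx; rewrite /= mulmxK // mul0mx.
- by rewrite /z /T Thk mulmx1 mulmxV // mxE eqxx.
(* Diagonals of triangular matrices multiply entrywise, so the diagonal of the operator of [p] is
   found from those of the variables: it consists of the values of [p] at the points [z l]. *)
pose RelT d (p : S) := exists T : 'M[K]_r,
  [/\ is_trig_mx T, forall l, T l l = p.@[z l] &
      Rel d p (invmx Q *m T *m Q)].
suff [A [tA dA RA]] : RelT d p.
  exists A; split=> // x; have := RA (x *m Q).
  by rewrite !mulmxA mulmxK.
have RelT1 : RelT 0%N 1.
  exists 1%:M; split=> [|l0|x]; first exact: scalar_mx_is_trig.
    by rewrite mxE eqxx meval1.
  by rewrite mulmx1 mulVmx // mulmx1 expr0 subrr; apply: in_ideal0.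
have RelTX i : RelT 1%N 'X_i.
  exists (T i); split=> // [l0|]; first by rewrite mevalXU.
  by rewrite /T !mulmxA mulVmx // mul1mx mulmxKV.
have RelTM d1 p1 d2 p2 : RelT d1 p1 -> RelT d2 p2 -> RelT (d1 + d2)%N (p1 * p2).
  move=> [A [/is_trig_mxP tA dA RA]] [B [/is_trig_mxP tB dB RB]].
  exists (B *m A); split.
  - apply/is_trig_mxP => i j ij; rewrite mxE big1 // => s _.
    have [is_|si] := ltnP i s; first by rewrite tB // mul0r.
    by rewrite tA ?mulr0 // (leq_ltn_trans si).
  - move=> l0; rewrite mxE (bigD1 l0) //= big1 ?addr0.
      by rewrite dA dB mevalM mulrC.
    move=> s; rewrite neq_ltn => /orP[sl|ls]; last by rewrite tB // mul0r.
    by rewrite tA // mulr0.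
  - have := RelM _ _ _ _ _ _ RA RB; congr Rel.
    by rewrite -!mulmxA; congr (_ *m (_ *m _)); rewrite !mulmxA mulmxV // mul1mx.
have RelTXm (m : 'X_{1..N}) : RelT (mdeg m) 'X_[m].
  rewrite mpolyXE_id mdegE.
  apply: (@big_ind2 _ _ (fun d p => RelT d p)) => // i _.
  elim: (m i) => [|j IHj]; first by rewrite expr0.
  by rewrite exprS -add1n; apply: RelTM.
have /choice[B /all_and3[tB dB RB]] := RelTXm.
exists (\sum_(m <- msupp p) p@_m *: B m); split.
- apply/is_trig_mxP => i j ij; rewrite summxE big1 // => m _.
  by rewrite mxE (is_trig_mxP (tB m)) ?mulr0.
- move=> l0; rewrite summxE mevalE; apply: eq_bigr => m _.
  by rewrite mxE dB mevalX.
move=> x; rewrite {1}[p]mpolyE.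
have -> : E (x *m (invmx Q *m (\sum_(m <- msupp p) p@_m *: B m) *m Q)) =
    \sum_(m <- msupp p) p@_m *: E (x *m (invmx Q *m B m *m Q)).
  rewrite mulmx_sumr mulmx_suml mulmx_sumr.
  rewrite (big_morph E (id1 := 0) (op1 := +%R)) => [|u v|//]; last first.
    by rewrite -[u]scale1r EZ !scale1r.
  apply: eq_bigr => m _; rewrite -scalemxAr -scalemxAl -scalemxAr.
  by rewrite -[X in E X]addr0 EZ E0 addr0.
rewrite mulr_suml mulr_sumr -sumrB big_seq; apply: in_ideal_sum => m mp.
rewrite -scalerAl -scalerAr -scalerBr; apply: in_idealZ.
by have := RB m x; rewrite (dhomog_mf hp mp).
Qed.

(** If [f] vanishes at none of the finitely many points [z l], the operator [f / 'X_k ^+ D] is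
    triangular with nonzero diagonal, hence invertible on the degree [m0] part. Injectivity makes
    [f] a nonzerodivisor, and surjectivity makes every form of degree at least [m0 + D] a multiple
    of [f] modulo the ideal. *)
Lemma exists_exchange D (F : 'I_N -> S) : (forall j, F j \is D.-homog) ->
  (forall x : 'I_N -> K, x k != 0 -> exists j, (F j).@[x] != 0) ->
  exists c : 'I_N -> K, let f := \sum_j c j *: F j in
    nonzerodivisor_mod P a f /\
    forall m p, (m0 + D <= m)%N -> p \is m.-homog -> exists u, J (p - u * f).
Proof.
move=> hF noz; have [r [E [z [[hE spanE] Ei zk opE]]]] := quotient_operators.
have [|c nzc] := @avoid_hyperplanes K 'I_r N (fun l j => (F j).@[z l]).
  by move=> l; apply: noz; rewrite zk oner_neq0.
exists c => f; have hf : f \is D.-homog by apply: rpred_sum => j _; apply: rpredZ.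
have [T [tT dT RT]] := opE D f hf.
have TU : T \in unitmx.
  rewrite unitmxE unitfE det_trig //; apply/prodf_neq0 => l _.
  by rewrite dT /f raddf_sum /=; under eq_bigr => j _ do rewrite mevalZ.
split=> [q u hu Ju|m p lem hp].
- have main (v : S) : v \is m0.-homog -> J (f * v) -> J v.
    move=> hv Jv; have [x Jx] := spanE v hv.
    suff x0 : x = 0.
      have -> : v = (v - E x) + E (0 *m T) by rewrite mul0mx -x0 subrK.
      apply: in_idealD => //.
      apply: (@quotient_Xn_nzd D m0) => //.
      have -> : 'X_k ^+ D * E (0 *m T) =
          f * v - f * (v - E x) - (f * E x - 'X_k ^+ D * E (x *m T)).
        by rewrite x0; ring.
      by do 2!apply: in_idealB => //; apply: in_idealM.
    have xT : x *m T = 0.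
      apply: Ei; apply: (@quotient_Xn_nzd D m0) => //.
      have -> : 'X_k ^+ D * E (x *m T) =
          f * v - f * (v - E x) - (f * E x - 'X_k ^+ D * E (x *m T)) by ring.
      by do 2!apply: in_idealB => //; apply: in_idealM.
    by rewrite -(mulmxK TU x) xT mul0mx.
  (* Other degrees are brought to [m0] by multiplying or dividing by a power of ['X_k], a
     nonzerodivisor modulo the ideal. *)
  have [qm|mq] := leqP q m0.
    apply: (@quotient_Xn_nzd (m0 - q) q) => //; apply: main.
      by have := dhomogM (Xnhomog k (m0 - q)) hu; rewrite subnK.
    by rewrite mulrCA; apply: in_idealM.
  have hu' : u \is (m0 + (q - m0)).-homog by rewrite subnKC // ltnW.
  have [v hv Jv] := quotient_divXn (leqnn m0) hu'.
  suff Jv0 : J v.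
    by rewrite -[u](subrK (v * 'X_k ^+ (q - m0))); apply: in_idealD => //;
       rewrite mulrC; apply: in_idealM.
  apply: main => //; apply: (@quotient_Xn_nzd (q - m0) (D + m0)).
    by rewrite dhomogM.
  have -> : 'X_k ^+ (q - m0) * (f * v) = f * u - f * (u - v * 'X_k ^+ (q - m0)).
    by ring.
  by apply: in_idealB => //; apply: in_idealM.
- have lem0 : (m0 <= m)%N := leq_trans (leq_addr D m0) lem.
  have hp' : p \is (m0 + (m - m0)).-homog by rewrite subnKC.
  have [v hv Jv] := quotient_divXn (leqnn m0) hp'.
  have [x Jx] := spanE v hv.
  have Dm : (D <= m - m0)%N by rewrite leq_subRL.
  pose j := (m - m0 - D)%N; have Ej : (m - m0 = j + D)%N by rewrite subnK.
  exists ('X_k ^+ j * E (x *m invmx T)).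
  have -> : p - 'X_k ^+ j * E (x *m invmx T) * f =
      (p - v * 'X_k ^+ (m - m0)) + 'X_k ^+ (m - m0) * (v - E x)
      - 'X_k ^+ j * (f * E (x *m invmx T) - 'X_k ^+ D * E (x *m invmx T *m T)).
    by rewrite mulmxKV // Ej exprD; ring.
  apply: in_idealB; first apply: in_idealD => //; exact: in_idealM.
Qed.

End Exchange.

Section Congruence.
Variables (K : numFieldType) (N : nat) (I : finType) (P : {set I}).
Local Notation S := {mpoly K[N]}.
Variables (a a' : I -> S) (da da' : I -> nat).
Hypothesis (eq_a : {in P, a =1 a'}) (eq_da : {in P, da =1 da'}).

Lemma eq_in_ideal u : in_ideal P a u -> in_ideal P a' u.
Proof.
by move=> [h ->]; exists h; apply: eq_bigr => i Pi; rewrite eq_a.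
Qed.

Lemma eq_koszul1 : koszul1 P a da -> koszul1 P a' da'.
Proof.
move=> kos q h th h0.
have [||s [sN ts sE]] := kos q (fun i => if i \in P then h i else 0).
- move=> i; case: ifP => Pi; last exact: twisted0.
  by rewrite eq_da.
- by rewrite -[RHS]h0; apply: eq_bigr => i Pi; rewrite Pi eq_a.
exists (fun i j => if (i \in P) && (j \in P) then s i j else 0).
split=> [i j|i j|i Pi].
- by rewrite andbC; case: ifP; rewrite ?oppr0.
- case: ifP => [/andP[Pi Pj]|_]; last exact: twisted0.
  by rewrite -!eq_da.
- have := sE i Pi; rewrite Pi => ->.
  by apply: eq_bigr => j Pj; rewrite Pj eq_a.
Qed.

End Congruence.

(* One after the other, the variables, which form a regular sequence, are
   exchanged for suitable linear combinations of the forms [F]. *)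
Theorem no_low_degree_syzygy (K : numClosedFieldType) N D d
    (F h : 'I_N -> {mpoly K[N]}) :
  (forall j, F j \is D.-homog) ->
  (forall x : 'I_N -> K, (exists k, x k != 0) -> exists j, (F j).@[x] != 0) ->
  (d < D)%N -> (forall i, h i \is d.-homog) ->
  \sum_i h i * F i = 0 -> forall i, h i = 0.
Proof.
move=> hF noz dD hh h0.
pose A k (g : 'I_N -> 'I_N -> K) (i : 'I_N) : {mpoly K[N]} :=
  if (i < k)%N then \sum_j g i j *: F j else 'X_i.
pose dA k (i : 'I_N) := if (i < k)%N then D else 1%N.
have hA k g i : A k g i \is (dA k i).-homog.
  rewrite /A /dA; case: ifP => _; last by rewrite dhomogX /= mdeg1.
  by apply: rpred_sum => j _; apply: rpredZ.
(* The ideal is required to contain all forms of large degree because this provides the hypothesis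
   [fin] of the next exchange. *)
have step k : (k <= N)%N -> exists g m0, koszul1 setT (A k g) (dA k) /\
    forall m (p : {mpoly K[N]}), (m0 <= m)%N -> p \is m.-homog ->
      in_ideal setT (A k g) p.
  elim: k => [_|k IHk lt_k].
    exists (fun _ _ => 0), 1%N; split.
      apply: (eq_koszul1 _ _ (@koszul1_variables K N)) => i _;
        by rewrite ?/A ?/dA ltn0.
    (* By Euler's formula every form of positive degree lies in the ideal of the variables, hence
       the initial bound 1. *)
    move=> m p m0 hp; exists (fun i => m%:R^-1 *: p^`M(i)).
    under eq_bigr => i _ do rewrite -scalerAl /A ltn0 mulrC.
    rewrite -scaler_sumr (eq_bigl predT) => [|i]; last by rewrite inE.
    rewrite (euler hp) scalerA mulVf ?scale1r // pnatr_eq0.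
    by case: m m0 hp.
  have [g [m0 [kos fin]]] := IHk (ltnW lt_k); pose i0 := Ordinal lt_k.
  have Ei0 : A k g i0 = 'X_i0 by rewrite /A ltnn.
  have nzd : nonzerodivisor_mod (setT :\ i0) (A k g) 'X_i0.
    by rewrite -Ei0; apply: koszul1_nonzerodivisor kos; rewrite ?inE.
  have fin' m p : (m0 <= m)%N -> p \is m.-homog ->
      exists u, in_ideal (setT :\ i0) (A k g) (p - u * 'X_i0).
    move=> m0m hp; have [u Eu] := fin m p m0m hp; exists (u i0); exists u.
    by rewrite Eu (big_setD1 i0 (in_setT i0)) /= Ei0 addrAC subrr add0r.
  have noz0 (x : 'I_N -> K) : x i0 != 0 -> exists j, (F j).@[x] != 0.
    by move=> xk; apply: noz; exists i0.
  have [c [nzdc finc]] := exists_exchange (hA k g) nzd fin' hF noz0.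
  pose g' i := if i == i0 then c else g i.
  have eqA : {in setT :\ i0, A k g =1 A k.+1 g'}.
    move=> i; rewrite !inE andbT => ni; rewrite /A /g' (negPf ni) ltnS [in RHS]leq_eqVlt.
    by rewrite -[nat_of_ord i == k]/(i == i0) (negPf ni).
  have eqdA : {in setT :\ i0, dA k =1 dA k.+1}.
    move=> i; rewrite !inE andbT => ni; rewrite /dA ltnS [in RHS]leq_eqVlt.
    by rewrite -[nat_of_ord i == k]/(i == i0) (negPf ni).
  have EA : A k.+1 g' i0 = \sum_j c j *: F j by rewrite /A ltnSn /g' eqxx.
  have kosD : koszul1 (setT :\ i0) (A k.+1 g') (dA k.+1).
    apply: (eq_koszul1 eqA eqdA); apply: koszul1D1 kos => //.
    by rewrite /dA ltnn.
  exists g', (m0 + D)%N; split.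
    apply: (koszul1U1 (hA k.+1 g') _ _ kosD) => //.
    move=> q u hu; rewrite EA => /(eq_in_ideal (a' := A k g)) Ju.
    apply: (eq_in_ideal eqA); apply: nzdc hu _; apply: Ju => i iP.
    by rewrite eqA.
  move=> m p m0m /(finc _ _ m0m)[u /(eq_in_ideal eqA)[v Ev]].
  exists (fun i => if i == i0 then u else v i).
  rewrite (big_setD1 i0 (in_setT i0)) /= eqxx EA; apply/eqP; rewrite addrC -subr_eq Ev.
  by apply/eqP/eq_bigr => i; rewrite !inE => /andP[/negPf ->].
have [g [m0 [kos _]]] := step N (leqnn N).
pose G := \matrix_(i, j) g i j.
have EA i : A N g i = \sum_j G i j *: F j.
  by rewrite /A ltn_ord; apply: eq_bigr => j _; rewrite mxE.
have EdA i : dA N i = D by rewrite /dA ltn_ord.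
have low e v : (e < D)%N -> (forall i, v i \is e.-homog) ->
    \sum_i v i * A N g i = 0 -> forall i, v i = 0.
  move=> eD hv v0 i; apply: (koszul1_low_degree EdA eD kos hv); rewrite ?inE //.
  by rewrite -[RHS]v0; apply: eq_bigl => j; rewrite inE.
(* A linear relation between the rows of [G] would be a syzygy of degree 0 of the exchanged family,
   and [0 < D]. *)
have GU : G \in unitmx.
  rewrite -row_free_unit -kermx_eq0; apply/eqP/row_matrixP => i; rewrite row0.
  set x := row i (kermx G).
  have xG : x *m G = 0 by rewrite /x -row_mul mulmx_ker row0.
  apply/rowP => j; rewrite [RHS]mxE.
  suff x0 : (x 0 j)%:MP = 0 :> {mpoly K[N]}.
    by have := congr1 (mcoeff 0%MM) x0; rewrite mcoeffC eqxx mulr1 mcoeff0.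
  apply: (low 0%N (fun j => (x 0 j)%:MP)) => [|l|]; first exact: leq_ltn_trans dD.
    by rewrite -[_%:MP]mulr1 mul_mpolyC rpredZ // dhomog1.
  under eq_bigr => l _ do rewrite EA mul_mpolyC scaler_sumr.
  rewrite exchange_big big1 //= => l _.
  have := congr1 (fun y : 'rV_N => y 0 l) xG; rewrite !mxE => Exl.
  under eq_bigr => j' _ do rewrite scalerA.
  by rewrite -scaler_suml Exl scale0r.
(* In the basis of the exchanged family the syzygy [h] becomes [h] times the inverse of [G], still
   of degree [d]. *)
pose v j := \sum_i invmx G i j *: h i.
have v0 : forall j, v j = 0.
  apply: (low d) => // [i|]; first by apply: rpred_sum => j _; apply: rpredZ; apply: hh.
  rewrite -[RHS]h0.
  have EF i : F i = \sum_j invmx G i j *: A N g j.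
    under eq_bigr => j _ do rewrite EA scaler_sumr.
    rewrite exchange_big /= (bigD1 i) //= [X in _ + X]big1 => [|l li].
      under eq_bigr => j _ do rewrite scalerA.
      have := congr1 (fun M : 'M_N => M i i) (mulVmx GU).
      by rewrite !mxE eqxx addr0 -scaler_suml => ->; rewrite scale1r.
    under eq_bigr => j _ do rewrite scalerA.
    have := congr1 (fun M : 'M_N => M i l) (mulVmx GU).
    by rewrite !mxE -scaler_suml => ->; rewrite eq_sym (negPf li) scale0r.
  under [RHS]eq_bigr => i _ do rewrite EF mulr_sumr.
  rewrite exchange_big; apply: eq_bigr => j _ /=; rewrite mulr_suml.
  by apply: eq_bigr => i _; rewrite -scalerAl scalerAr.
move=> i; have : \sum_j G j i *: v j = 0.
  by rewrite big1 // => j _; rewrite v0 scaler0.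
under eq_bigr => j _ do rewrite scaler_sumr.
rewrite exchange_big /= (bigD1 i) //= [X in _ + X]big1 => [|l li].
  under eq_bigr => j _ do rewrite scalerA mulrC.
  have := congr1 (fun M : 'M_N => M i i) (mulVmx GU).
  by rewrite !mxE eqxx addr0 -scaler_suml => ->; rewrite scale1r.
under eq_bigr => j _ do rewrite scalerA mulrC.
have := congr1 (fun M : 'M_N => M l i) (mulVmx GU).
by rewrite !mxE -scaler_suml => ->; rewrite (negPf li) scale0r.
Qed.

(** * Derivations *)

Lemma mpoly_ring_ind (R : comNzRingType) N (P : {mpoly R[N]} -> Prop) :
  (forall c, P c%:MP) -> (forall i, P 'X_i) ->
  (forall p q, P p -> P q -> P (p + q)) ->
  (forall p q, P p -> P q -> P (p * q)) -> forall p, P p.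
Proof.
move=> PC PX PD PM; elim/mpolyind => [|c m p _ _ Pp]; first by rewrite -mpolyC0.
apply: PD => //; rewrite -mul_mpolyC; apply: (PM) => //.
rewrite mpolyXE_id; apply: (big_ind P) => [||i _]; [by rewrite -mpolyC1 | exact: PM |].
by elim: (m i) => [|k IHk]; rewrite ?expr0 ?exprS -?mpolyC1 //; apply: PM.
Qed.

Section Derivation.
Variables (A B : comNzRingType).

(** With [phi] a ring morphism other than the identity, this covers a derivation composed with a
    substitution on either side, so that two such composites can be compared on generators. *)
Definition derivation_along (phi D : A -> B) :=
  (forall u v, D (u + v) = D u + D v) /\
  (forall u v, D (u * v) = D u * phi v + phi u * D v).

Lemma derivation_along0 phi D : derivation_along phi D -> D 0 = 0.
Proof.
by case=> DD _; apply: (addrI (D 0)); rewrite -DD !addr0.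
Qed.

Lemma derivation_along_sum phi D (I : Type) (r : seq I) (P : pred I) F :
  derivation_along phi D ->
  D (\sum_(i <- r | P i) F i) = \sum_(i <- r | P i) D (F i).
Proof.
by move=> der; apply: (big_morph D der.1 (derivation_along0 der)).
Qed.

End Derivation.

Notation derivation D := (derivation_along id D).

Section Combinations.
Variable B : comNzRingType.

Lemma derivationD (D E : B -> B) : derivation D -> derivation E ->
  derivation (fun x => D x + E x).
Proof.
move=> [DD DM] [ED EM]; split=> u v; first by rewrite DD ED addrACA.
by rewrite DM EM; ring.
Qed.

Lemma derivationM (b : B) (D : B -> B) :
  derivation D -> derivation (fun x => b * D x).
Proof.
by move=> [DD DM]; split=> u v; rewrite ?DD ?mulrDr // DM; ring.
Qed.

Lemma derivationN (D : B -> B) : derivation D -> derivation (fun x => - D x).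
Proof. by move=> [DD DM]; split=> u v; rewrite ?DD ?opprD // DM; ring. Qed.

Lemma derivation_big (I : finType) (D : I -> B -> B) :
  (forall i, derivation (D i)) -> derivation (fun x => \sum_i D i x).
Proof.
move=> DD; split=> u v.
  by rewrite -big_split; apply: eq_bigr => i _; case: (DD i).
rewrite mulr_suml mulr_sumr -big_split; apply: eq_bigr => i _.
by case: (DD i).
Qed.

Lemma derivation_prod (D : B -> B) (I : finType) (F : I -> B) : derivation D ->
  D (\prod_i F i) = \sum_k D (F k) * \prod_(i | i != k) F i.
Proof.
move=> der; have [DD DM] := der.
have D1 : D 1 = 0.
  by apply: (addrI (D 1)); rewrite addr0 -[in RHS](mulr1 1) DM mulr1 mul1r.
pose P (r : seq I) := D (\prod_(i <- r) F i) =
  \sum_(k <- r) D (F k) * \prod_(i <- r | i != k) F i.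
suff : forall r, uniq r -> P r by apply; apply: index_enum_uniq.
elim=> [|j r IHr] /=; first by rewrite /P !big_nil D1.
move=> /andP[jr ur]; rewrite /P big_cons DM IHr // big_cons big_cons eqxx /=.
congr (_ + _).
  congr (_ * _); rewrite [RHS]big_seq_cond [LHS]big_seq; apply: eq_bigl => i.
  by case: eqP => [->|]; rewrite ?(negPf jr) ?andbT.
rewrite mulr_sumr [LHS]big_seq [RHS]big_seq; apply: eq_bigr => k kr.
rewrite big_cons; case: eqP kr => [<-|_ _]; first by rewrite (negPf jr).
by rewrite mulrCA.
Qed.

(** Jacobi's formula: differentiate one row at a time and expand along that row. *)
Lemma derivation_det (D : B -> B) r (M : 'M[B]_r) : derivation D ->
  D (\det M) = \tr (map_mx D M *m \adj M).
Proof.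
move=> der; have [DD DM] := der.
have Dsign (b : bool) x : D ((-1) ^+ b * x) = (-1) ^+ b * D x.
  have D0 := derivation_along0 der.
  case: b; rewrite ?expr1 ?expr0 ?mulN1r ?mul1r //.
  by apply/eqP; rewrite -addr_eq0 -DD addNr D0.
pose Mk k := \matrix_(i, j) (if i == k then D (M i j) else M i j).
rewrite /determinant (derivation_along_sum _ _ _ der).
transitivity (\sum_k \det (Mk k)).
  rewrite exchange_big; apply: eq_bigr => s _ /=.
  rewrite Dsign (derivation_prod _ der) mulr_sumr; apply: eq_bigr => k _.
  congr (_ * _); rewrite [RHS](bigD1 k) //= mxE eqxx; congr (_ * _).
  by apply: eq_bigr => i /negPf ik; rewrite mxE ik.
apply: eq_bigr => k _; rewrite (expand_det_row _ k) mxE; apply: eq_bigr => j _.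
rewrite !mxE eqxx; congr (_ * _); rewrite /cofactor; congr (_ * \det _).
by apply/matrixP => i l; rewrite !mxE eq_sym (negPf (neq_lift _ _)).
Qed.

End Combinations.

Section Polynomials.
Variables (K : comNzRingType) (N : nat).
Local Notation C := {mpoly K[N]}.

Lemma derivation_along_mpoly_eq (R : comNzRingType) (phi D E : C -> R) :
  derivation_along phi D -> derivation_along phi E ->
  (forall c, D c%:MP = E c%:MP) -> (forall i, D 'X_i = E 'X_i) -> D =1 E.
Proof.
move=> [DD DM] [ED EM] eqC eqX; elim/mpoly_ring_ind => // p q Hp Hq.
  by rewrite DD ED Hp Hq.
by rewrite DM EM Hp Hq.
Qed.

Lemma derivation_along_poly_eq (R : comNzRingType) (phi D E : {poly C} -> R) :
  derivation_along phi D -> derivation_along phi E ->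
  (forall c, D c%:MP%:P = E c%:MP%:P) -> (forall i, D ('X_i)%:P = E ('X_i)%:P) ->
  D 'X = E 'X -> D =1 E.
Proof.
move=> derD derE eqC eqX eqt; have [DD DM] := derD; have [ED EM] := derE.
have eqP : forall c, D c%:P = E c%:P.
  apply: (@derivation_along_mpoly_eq _ (phi \o polyC)) => //=.
    by split=> u v; rewrite ?polyCD ?polyCM /= ?DD ?DM.
  by split=> u v; rewrite ?polyCD ?polyCM /= ?ED ?EM.
elim/poly_ind => [|p c Hp].
  by rewrite (derivation_along0 derD) (derivation_along0 derE).
by rewrite DD ED DM EM Hp eqt eqP.
Qed.

Lemma derivation_mmap (R : comNzRingType) (iota : {rmorphism K -> R})
    (h : 'I_N -> R) (D : R -> R) (p : C) :
  derivation D -> (forall c, D (iota c) = 0) ->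
  D (mmap iota h p) = \sum_i mmap iota h p^`M(i) * D (h i).
Proof.
move=> der Dc; have [DD DM] := der.
apply: (@derivation_along_mpoly_eq _ (mmap iota h)
          (fun p => D (mmap iota h p))
          (fun p => \sum_i mmap iota h p^`M(i) * D (h i))) => [||c|i].
- by split=> u v; rewrite ?rmorphD ?rmorphM /= ?DD ?DM.
- split=> u v.
    rewrite -big_split; apply: eq_bigr => i _ /=.
    by rewrite mderivD rmorphD mulrDl.
  rewrite mulr_suml mulr_sumr -big_split; apply: eq_bigr => i _ /=.
  by rewrite mderivM rmorphD !rmorphM /=; ring.
- rewrite mmapC Dc big1 // => i _.
  by rewrite mderivC rmorph0 mul0r.
- rewrite mmapX mmap1U (bigD1 i) //= big1 => [|j ji]; rewrite mderivX mnm1E.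
    have -> : (U_(i) - U_(i) = 0)%MM.
      by apply/mnmP => k; rewrite mnmBE subnn mnm0E.
    by rewrite eqxx scale1r mpolyX0 rmorph1 mul1r addr0.
  by rewrite eq_sym (negPf ji) scale0r rmorph0 mul0r.
Qed.

Definition cderiv (i : 'I_N) (p : {poly C}) : {poly C} := map_poly (mderiv i) p.

Lemma coef_cderiv i p k : (cderiv i p)`_k = p`_k^`M(i).
Proof. by rewrite coef_map_id0 // mderiv0. Qed.

Lemma cderivC i c : cderiv i c%:P = (c^`M(i))%:P.
Proof. exact: (map_polyC (mderiv i)). Qed.

Lemma cderivX i : cderiv i 'X = 0.
Proof.
apply/polyP => k; rewrite coef_cderiv coefX coef0.
by case: (k == 1%N); [rewrite -mpolyC1 mderivC | rewrite mderiv0].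
Qed.

Lemma derivation_cderiv i : derivation (cderiv i).
Proof.
split=> u v; apply/polyP => k; rewrite !(coef_cderiv, coefD) ?mderivD //.
rewrite !coefM raddf_sum -big_split; apply: eq_bigr => j _ /=.
by rewrite mderivM !coef_cderiv.
Qed.

Lemma derivation_deriv : derivation (@deriv C).
Proof. by split=> u v; rewrite ?derivD ?derivM. Qed.

Lemma size_cderiv i p : (size (cderiv i p) <= size p)%N.
Proof. exact: size_poly. Qed.

End Polynomials.

Arguments derivation_cderiv {K N} i.

(** * Vector fields on the space of curves *)

Section GenericCurve.
Variables (K : numFieldType) (n e : nat).
Local Notation N := (n.+1 * e.+1)%N.
Local Notation C := {mpoly K[N]}.
Local Notation B := {poly C}.
Implicit Types (j : 'I_n.+1) (k : 'I_e.+1) (l : 'I_e).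

Definition coef_var j k : C := 'X_(mxvec_index j k).

(* The generic curve of degree [e], in an affine coordinate ['X] of the source
   line. *)
Definition generic_curve j : B := \sum_k (coef_var j k)%:P * 'X^k.

Definition pull (p : {mpoly K[n.+1]}) : B :=
  mmap (polyC \o @mpolyC N K) generic_curve p.

Lemma pull_is_additive : additive pull.
Proof. by move=> p q; rewrite /pull rmorphB. Qed.

Lemma pull_is_multiplicative : multiplicative pull.
Proof. by split=> [p q|]; rewrite /pull ?rmorphM ?rmorph1. Qed.

HB.instance Definition _ := GRing.isAdditive.Build _ _ pull pull_is_additive.
HB.instance Definition _ := GRing.isMultiplicative.Build _ _ pull
  pull_is_multiplicative.

Lemma pullC c : pull c%:MP = c%:MP%:P.
Proof. exact: mmapC. Qed.

Lemma pullX j : pull 'X_j = generic_curve j.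
Proof. by rewrite /pull mmapX mmap1U. Qed.

Lemma pullM : {morph pull : p q / p * q}.
Proof. exact: rmorphM. Qed.

Lemma pullXn p m : pull (p ^+ m) = pull p ^+ m.
Proof. exact: rmorphXn. Qed.

Lemma pull_sum (I : Type) (r : seq I) (P : pred I) F :
  pull (\sum_(i <- r | P i) F i) = \sum_(i <- r | P i) pull (F i).
Proof. exact: rmorph_sum. Qed.

Lemma pull_prod (I : Type) (r : seq I) (P : pred I) F :
  pull (\prod_(i <- r | P i) F i) = \prod_(i <- r | P i) pull (F i).
Proof. exact: rmorph_prod. Qed.

Lemma mxvec_index_eq j k j' k' :
  (mxvec_index j k == mxvec_index j' k') = (j == j') && (k == k').
Proof.
apply/eqP/andP => [E|[/eqP-> /eqP->] //].
pose A := \matrix_(j < n.+1, k < e.+1) (j, k).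
have := congr1 (mxvec A 0) E; rewrite !mxvecE !mxE => -[-> ->].
by rewrite !eqxx.
Qed.

Lemma deriv_coef_var j k j' k' :
  (coef_var j k)^`M(mxvec_index j' k') = ((j == j') && (k == k'))%:R.
Proof.
rewrite mderivX mnm1E mxvec_index_eq.
case: eqP => [->|_]; last by rewrite scale0r.
case: eqP => [->|_]; last by rewrite scale0r.
have -> : (U_(mxvec_index j' k') - U_(mxvec_index j' k') = 0)%MM.
  by apply/mnmP => i; rewrite mnmBE subnn mnm0E.
by rewrite scale1r mpolyX0.
Qed.

Lemma cderiv_coef_var j k j' k' :
  cderiv (mxvec_index j' k') (coef_var j k)%:P = ((j == j') && (k == k'))%:R.
Proof.
by rewrite cderivC deriv_coef_var; case: (_ && _).
Qed.

Lemma deriv_polyC (c : C) : deriv c%:P = 0.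
Proof. exact: derivC. Qed.

(* The vector fields on the space of curves with parameter: they annihilate
   the generic curve and raise the degree in the parameter by at most one. *)
Definition slide j l (p : B) : B :=
  cderiv (mxvec_index j (lift ord0 l)) p
  - 'X * cderiv (mxvec_index j (widen_ord (leqnSn e) l)) p.

Definition shift (p : B) : B :=
  p^`() - \sum_j \sum_l (coef_var j (lift ord0 l) *+ l.+1)%:P *
            cderiv (mxvec_index j (widen_ord (leqnSn e) l)) p.

(** These lie in the span of the previous fields with coefficients in [B]: [slide_to0 j k.+1] is a
    [slide] plus ['X] times [slide_to0 j k]. They may raise the degree by more than one, but they
    are used only where divisibility matters. *)
Definition slide_to0 j k (p : B) : B :=
  cderiv (mxvec_index j k) p - 'X^k * cderiv (mxvec_index j ord0) p.

Definition shift_to0 (p : B) : B :=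
  p^`() - \sum_j \sum_l (coef_var j (lift ord0 l) *+ l.+1)%:P * 'X^l *
            cderiv (mxvec_index j ord0) p.

Lemma derivation_slide j l : derivation (slide j l).
Proof.
apply: derivationD; first exact: derivation_cderiv.
by apply/derivationN/derivationM/derivation_cderiv.
Qed.

Lemma derivation_shift : derivation shift.
Proof.
apply: derivationD; first exact: derivation_deriv.
apply: derivationN; apply: derivation_big => j; apply: derivation_big => l.
by apply/derivationM/derivation_cderiv.
Qed.

Lemma derivation_slide_to0 j k : derivation (slide_to0 j k).
Proof.
apply: derivationD; first exact: derivation_cderiv.
by apply/derivationN/derivationM/derivation_cderiv.
Qed.

Lemma derivation_shift_to0 : derivation shift_to0.
Proof.
apply: derivationD; first exact: derivation_deriv.
apply: derivationN; apply: derivation_big => j; apply: derivation_big => l.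
by apply/derivationM/derivation_cderiv.
Qed.

Lemma cderiv_const (v : 'I_N) (c : K) : cderiv v c%:MP%:P = 0.
Proof. by rewrite cderivC mderivC polyC0. Qed.

Lemma slide_const j l (c : K) : slide j l c%:MP%:P = 0.
Proof. by rewrite /slide !cderiv_const mulr0 subrr. Qed.

Lemma shift_const (c : K) : shift c%:MP%:P = 0.
Proof.
rewrite /shift deriv_polyC big1 ?subrr // => j _; rewrite big1 // => l _.
by rewrite cderiv_const mulr0.
Qed.

Lemma cderiv_Xn (v : 'I_N) m : cderiv v 'X^m = 0 :> B.
Proof.
elim: m => [|m IHm]; first by rewrite expr0 -polyC1 -mpolyC1 cderiv_const.
by rewrite exprS (derivation_cderiv v).2 IHm cderivX mulr0 mul0r addr0.
Qed.

Lemma cderiv_curve j k j' :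
  cderiv (mxvec_index j k) (generic_curve j') = (j' == j)%:R * 'X^k.
Proof.
rewrite /generic_curve (derivation_along_sum _ _ _ (derivation_cderiv _)).
under eq_bigr => k' _ do
  rewrite (derivation_cderiv _).2 cderiv_Xn mulr0 addr0 cderiv_coef_var.
rewrite (bigD1 k) //= eqxx andbT big1 ?addr0 // => k' /negPf k'k.
by rewrite k'k andbF mul0r.
Qed.

Lemma slide_curve j l j' : slide j l (generic_curve j') = 0.
Proof.
rewrite /slide !cderiv_curve /= /bump /= add1n exprS mulrCA subrr //.
Qed.

Lemma deriv_curve j :
  (generic_curve j)^`() = \sum_l (coef_var j (lift ord0 l) *+ l.+1)%:P * 'X^l.
Proof.
rewrite /generic_curve big_ord_recl derivD expr0 mulr1 derivC add0r.
rewrite raddf_sum; apply: eq_bigr => l _ /=.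
rewrite derivM derivC mul0r add0r derivXn /= /bump /= add1n /= mulrnAr.
by rewrite -mulrnAl -polyCMn.
Qed.

Lemma shift_curve j : shift (generic_curve j) = 0.
Proof.
rewrite /shift deriv_curve (bigD1 j) //= [X in _ - (_ + X)]big1 => [|j' /negPf jj'].
  rewrite addr0 -sumrB big1 // => l _.
  by rewrite cderiv_curve eqxx mul1r /= subrr.
by apply: big1 => l _; rewrite cderiv_curve eq_sym jj' mul0r mulr0.
Qed.

Lemma pull_derivation0 (D : B -> B) p : derivation D ->
  (forall c, D c%:MP%:P = 0) -> (forall j, D (generic_curve j) = 0) ->
  D (pull p) = 0.
Proof.
move=> der Dc Df; rewrite (derivation_mmap _ _ der) //.
by apply: big1 => j _; rewrite Df mulr0.
Qed.

Lemma size_polyCM_le (c : C) (p : B) : (size (c%:P * p)%R <= size p)%N.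
Proof. by rewrite mul_polyC size_scale_leq. Qed.

Lemma size_slide j l p : (size (slide j l p) <= (size p).+1)%N.
Proof.
apply: leq_trans (size_polyD _ _) _; rewrite geq_max size_polyN.
rewrite (leq_trans (size_cderiv _ _)) //=.
apply: leq_trans (size_polyMleq _ _) _; rewrite size_polyX /=.
by rewrite ltnS size_cderiv.
Qed.

Lemma size_shift p : (size (shift p) <= size p)%N.
Proof.
apply: leq_trans (size_polyD _ _) _; rewrite geq_max size_polyN; apply/andP; split.
  have [->|p0] := eqVneq p 0; first by rewrite deriv0.
  exact: ltnW (lt_size_deriv p0).
apply: leq_trans (size_sum _ _ _) _; apply/bigmax_leqP => j _.
apply: leq_trans (size_sum _ _ _) _; apply/bigmax_leqP => l _.
exact: leq_trans (size_polyCM_le _ _) (size_cderiv _ _).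
Qed.

Lemma slide_to0_divides (w : B) j k : (forall l, divides w (slide j l w)) ->
  divides w (slide_to0 j k w).
Proof.
move=> dvdw; case: k => k; elim: k => [|k IHk] lt_k.
  have -> : Ordinal lt_k = ord0 by apply: val_inj.
  by rewrite /slide_to0 expr0 mul1r subrr; apply: divides0.
pose l : 'I_e := Ordinal (lt_k : (k < e)%N).
have E1 : Ordinal lt_k = lift ord0 l by apply: val_inj.
have E2 : Ordinal (ltnW lt_k) = widen_ord (leqnSn e) l by apply: val_inj.
have -> : slide_to0 j (Ordinal lt_k) w =
    slide j l w + 'X * slide_to0 j (Ordinal (ltnW lt_k)) w.
  by rewrite /slide_to0 /slide E1 E2 /= /bump /= add1n exprS; ring.
by apply: dividesD; [apply: dvdw | apply: divides_mull].
Qed.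

Lemma shift_to0_divides (w : B) : (forall j l, divides w (slide j l w)) ->
  divides w (shift w) -> divides w (shift_to0 w).
Proof.
move=> dvdw dvds.
have -> : shift_to0 w = shift w + \sum_j \sum_l
    (coef_var j (lift ord0 l) *+ l.+1)%:P *
      slide_to0 j (widen_ord (leqnSn e) l) w.
  rewrite /shift_to0 /shift -addrA; congr (_ + _); rewrite addrC -sumrB -sumrN.
  apply: eq_bigr => j _; rewrite -sumrB -sumrN; apply: eq_bigr => l _.
  by rewrite /slide_to0 mulrBr -mulrA addrAC subrr add0r.
apply: dividesD => //; apply: divides_sum => j _; apply: divides_sum => l _.
by apply: divides_mull; apply: slide_to0_divides.
Qed.

Definition subst_var (H : 'M[B]_(n.+1, e.+1)) (v : 'I_N) : B := mxvec H 0 v.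

Definition subst_coef H (c : C) : B :=
  mmap (polyC \o @mpolyC N K) (subst_var H) c.

Lemma subst_coef_is_additive H : additive (subst_coef H).
Proof. by move=> p q; rewrite /subst_coef rmorphB. Qed.

Lemma subst_coef_is_multiplicative H : multiplicative (subst_coef H).
Proof. by split=> [p q|]; rewrite /subst_coef ?rmorphM ?rmorph1. Qed.

HB.instance Definition _ H := GRing.isAdditive.Build _ _ (subst_coef H)
  (subst_coef_is_additive H).
HB.instance Definition _ H := GRing.isMultiplicative.Build _ _ (subst_coef H)
  (subst_coef_is_multiplicative H).

(** The values substituted for the curve coefficients may involve ['X], so coefficients are mapped
    into [B] before the outer variable is evaluated at ['X]. *)
Definition subst H (p : B) : B := (map_poly (subst_coef H) p).['X].

Lemma substD H : {morph subst H : p q / p + q}.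
Proof. by move=> p q; rewrite /subst rmorphD hornerD. Qed.

Lemma substM H : {morph subst H : p q / p * q}.
Proof. by move=> p q; rewrite /subst rmorphM hornerM. Qed.

Lemma subst_polyC H c : subst H c%:P = subst_coef H c.
Proof. by rewrite /subst map_polyC hornerC. Qed.

Lemma subst_const H (c : K) : subst H c%:MP%:P = c%:MP%:P.
Proof. by rewrite subst_polyC; apply: mmapC. Qed.

Lemma subst_polyX H : subst H 'X = 'X.
Proof. by rewrite /subst map_polyX hornerX. Qed.

Lemma subst_coef_var H j k : subst H (coef_var j k)%:P = H j k.
Proof. by rewrite subst_polyC /subst_coef mmapX mmap1U /subst_var mxvecE. Qed.

Lemma subst0 H : subst H 0 = 0.
Proof. by rewrite /subst map_poly0 horner0. Qed.

Lemma substN H p : subst H (- p) = - subst H p.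
Proof. by apply/eqP; rewrite -addr_eq0 -substD addNr subst0. Qed.

Lemma subst_sum H (I : Type) (r : seq I) (P : pred I) (F : I -> B) :
  subst H (\sum_(i <- r | P i) F i) = \sum_(i <- r | P i) subst H (F i).
Proof. exact: (big_morph _ (substD H) (subst0 H)). Qed.

Lemma subst_Xn H m : subst H 'X^m = 'X^m.
Proof.
elim: m => [|m IHm]; last by rewrite exprS substM IHm subst_polyX.
by rewrite expr0 -polyC1 -mpolyC1 subst_const.
Qed.

Definition tail j : B := \sum_l (coef_var j (lift ord0 l))%:P * 'X^(l.+1).

Lemma generic_curveE j : generic_curve j = (coef_var j ord0)%:P + tail j.
Proof.
by rewrite /generic_curve big_ord_recl expr0 mulr1.
Qed.

(* In the coordinates in which the value of the curve at ['X] replaces its value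
   at [0], the fields [slide_to0] and [shift_to0] are partial derivatives. *)
Definition straighten := subst
  (\matrix_(j, k) if k == ord0 then (coef_var j k)%:P - tail j
                  else (coef_var j k)%:P).

Definition unstraighten := subst
  (\matrix_(j, k) if k == ord0 then generic_curve j else (coef_var j k)%:P).

Lemma mxvec_index_ind (P : 'I_N -> Prop) :
  (forall j k, P (mxvec_index j k)) -> forall v, P v.
Proof. by move=> HP v; case/mxvec_indexP: v. Qed.

Lemma straightenK : cancel straighten unstraighten.
Proof.
have tailU j : unstraighten (tail j) = tail j.
  rewrite /unstraighten subst_sum; apply: eq_bigr => l _.
  by rewrite substM subst_Xn subst_coef_var mxE.
elim/poly_ind => [|p c IHp]; first by rewrite /straighten /unstraighten !subst0.
transitivity (unstraighten (straighten p) * 'X +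
              unstraighten (straighten c%:P)).
  by rewrite /straighten /unstraighten !substD !substM !subst_polyX.
apply: (f_equal2 (fun x y => x * 'X + y)); first exact: IHp.
elim/mpoly_ring_ind: c => [c|v|p1 q1 H1 H2|p1 q1 H1 H2].
- by rewrite /straighten /unstraighten !subst_const.
- elim/mxvec_index_ind: v => j k.
  rewrite -[('X_(mxvec_index j k))%:P]/((coef_var j k)%:P).
  rewrite {1}/straighten subst_coef_var mxE; case: eqP => [->|/eqP/negPf nk].
    rewrite {1}/unstraighten substD substN -/unstraighten tailU.
    by rewrite {1}/unstraighten subst_coef_var mxE eqxx generic_curveE addrK.
  by rewrite /unstraighten subst_coef_var mxE nk.
- by rewrite polyCD -{2}H1 -{2}H2 /straighten /unstraighten !substD.
- by rewrite polyCM -{2}H1 -{2}H2 /straighten /unstraighten !substM.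
Qed.

Lemma derivation_along_subst_l H (D : B -> B) :
  derivation D -> derivation_along (subst H) (fun p => D (subst H p)).
Proof.
by move=> [DD DM]; split=> u v; rewrite ?substD ?substM ?DD ?DM.
Qed.

Lemma derivation_along_subst_r H (D : B -> B) :
  derivation D -> derivation_along (subst H) (fun p => subst H (D p)).
Proof.
by move=> [DD DM]; split=> u v; rewrite ?DD ?DM ?substD ?substM.
Qed.

Lemma cderiv_tail j l j' : cderiv (mxvec_index j (lift ord0 l)) (tail j') =
  (j' == j)%:R * 'X^(l.+1).
Proof.
have := cderiv_curve j (lift ord0 l) j'.
rewrite generic_curveE (derivation_cderiv _).1 cderiv_coef_var andbF add0r.
by move=> ->; rewrite /= /bump /= add1n.
Qed.

(** Both sides are derivations along [straighten], so generators suffice. On [coef_var j ord0], the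
    subtracted tail accounts for the compensating term of [slide_to0]. *)
Lemma straighten_slide_to0 j l p :
  straighten (slide_to0 j (lift ord0 l) p) =
  cderiv (mxvec_index j (lift ord0 l)) (straighten p).
Proof.
move: p; apply: (derivation_along_poly_eq (phi := straighten)).
- exact/derivation_along_subst_r/derivation_slide_to0.
- exact/derivation_along_subst_l/derivation_cderiv.
- move=> c; rewrite /straighten subst_const /slide_to0 !cderiv_const.
  by rewrite mulr0 subrr subst0.
- elim/mxvec_index_ind => j' k.
  rewrite -[('X_(mxvec_index j' k))%:P]/((coef_var j' k)%:P).
  rewrite /slide_to0 !cderiv_coef_var /straighten subst_coef_var mxE.
  have subst_nat (b : bool) H : subst H b%:R = b%:R.
    by case: b; rewrite ?subst0 // -polyC1 -mpolyC1 subst_const.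
  rewrite substD substN substM subst_Xn !subst_nat.
  case: (eqVneq k ord0) => [->|nk].
    have D0 := derivation_along0 (derivation_cderiv (mxvec_index j (lift ord0 l))).
    have -> : cderiv (mxvec_index j (lift ord0 l)) ((coef_var j' ord0)%:P - tail j') =
              - cderiv (mxvec_index j (lift ord0 l)) (tail j').
      apply/eqP; rewrite -addr_eq0 -(derivation_cderiv _).1 subrK.
      by rewrite cderiv_coef_var andbF.
    by rewrite cderiv_tail andbT andbF sub0r mulrC /= /bump /= add1n.
  by rewrite cderiv_coef_var andbF mulr0 subr0.
- by rewrite /slide_to0 /straighten subst_polyX !cderivX mulr0 subrr subst0.
Qed.

Lemma deriv_tail j :
  (tail j)^`() = \sum_l (coef_var j (lift ord0 l) *+ l.+1)%:P * 'X^l.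
Proof.
by rewrite -deriv_curve generic_curveE derivD derivC add0r.
Qed.

Lemma straighten_shift_to0 p : straighten (shift_to0 p) = (straighten p)^`().
Proof.
move: p; apply: (derivation_along_poly_eq (phi := straighten)).
- exact/derivation_along_subst_r/derivation_shift_to0.
- exact/derivation_along_subst_l/derivation_deriv.
- move=> c; rewrite /straighten subst_const /shift_to0 deriv_polyC.
  rewrite big1 ?subrr ?subst0 // => j _; rewrite big1 // => l _.
  by rewrite cderiv_const mulr0.
- elim/mxvec_index_ind => j' k.
  rewrite -[('X_(mxvec_index j' k))%:P]/((coef_var j' k)%:P).
  rewrite /shift_to0 deriv_polyC sub0r /straighten subst_coef_var mxE.
  rewrite (bigD1 j') //= [X in _ + X]big1 ?addr0 => [|j /negPf jj'].
    under eq_bigr => l _ do rewrite cderiv_coef_var eqxx /=.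
    case: eqP => [->|/eqP/negPf nk]; last first.
      rewrite deriv_polyC big1 ?oppr0 ?subst0 // => l _.
      by rewrite mulr0.
    rewrite derivB derivC sub0r substN deriv_tail; congr (- _).
    rewrite subst_sum; apply: eq_bigr => l _.
    rewrite mulr1 substM subst_Xn polyCMn; congr (_ * _).
    rewrite -mulr_natr substM subst_coef_var mxE /= mulr_natr.
    have subst_natr m H : subst H m%:R = m%:R.
      elim: m => [|m IHm]; first by rewrite subst0.
      rewrite !mulrS substD IHm; congr (_ + _).
      by rewrite -polyC1 -mpolyC1 subst_const.
    by rewrite subst_natr mulr_natr.
  by rewrite big1 // => l _; rewrite cderiv_coef_var eq_sym jj' mulr0.
- rewrite /shift_to0 /straighten subst_polyX derivX big1 ?subr0 => [|j _].
    by rewrite -polyC1 -mpolyC1 subst_const.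
  by rewrite big1 // => l _; rewrite cderivX mulr0.
Qed.

End GenericCurve.

Lemma exists_mnonroot (K : numFieldType) N (p : {mpoly K[N]}) :
  p != 0 -> exists x, p.@[x] != 0.
Proof.
elim: N p => [|N IHN] p p0.
  exists (fun=> 0); apply: contraNneq p0.
  by rewrite -[p]mpolyKC mevalC => ->; rewrite mpolyC0.
have q0 : muni p != 0.
  by apply: contraNneq p0 => E; rewrite -[p]muniK E /mpoly_of_poly map_poly0 horner0.
have [|x x0] := IHN (lead_coef (muni p)); first by rewrite lead_coef_eq0.
pose q := map_poly (meval x) (muni p).
have [|y y0] := @exists_nonroot K q.
  apply: contraNneq x0 => E; rewrite lead_coefE.
  by have := congr1 (coefp (size (muni p)).-1) E; rewrite /= coef_map coef0 => ->.
exists (fun i => oapp x y (unlift ord_max i)).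
suff -> : p.@[fun i => oapp x y (unlift ord_max i)] = q.[y] by [].
rewrite /q; elim/mpoly_ring_ind: p {p0 q0 x0 q y0} => [c|i|p r Hp Hr|p r Hp Hr].
- by rewrite mevalC muniC map_polyC hornerC /= mevalC.
- rewrite mevalXU; case: unliftP => [j ->|->] /=; last first.
    by rewrite muni_Xmax map_polyX hornerX.
  have -> : lift ord_max j = widen_ord (leqnSn N) j.
    by apply: val_inj; rewrite /= /bump leqNgt ltn_ord.
  rewrite -[X in muni X](_ : mwiden 'X_j = _); last by rewrite mwidenX mnmwiden1.
  by rewrite muni_mwiden map_polyC hornerC /= mevalXU.
- by rewrite mevalD muniD rmorphD hornerD; apply: (f_equal2 +%R Hp Hr).
- by rewrite mevalM muniM rmorphM hornerM; apply: (f_equal2 *%R Hp Hr).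
Qed.

(** * Descent of polynomials that divide their own derivatives *)

Section MpolyDivides.
Variables (K : numFieldType) (N : nat).
Local Notation C := {mpoly K[N]}.

Lemma mpoly_mulrn_eq0 (c : C) m : c *+ m.+1 = 0 -> c = 0.
Proof.
by move/eqP; rewrite -scaler_nat scaler_eq0 pnatr_eq0 => /eqP.
Qed.

Lemma msize_deriv_lt (c : C) v : c != 0 -> (msize c^`M(v) < msize c)%N.
Proof.
move=> c0; rewrite msizeE; have := c0; rewrite -msize_poly_eq0 -lt0n => s0.
rewrite -(prednK s0) ltnS; apply/bigmax_leqP_seq => m + _.
rewrite mcoeff_msupp mcoeff_deriv => cm.
rewrite -ltnS prednK //; have : (m + U_(v))%MM \in msupp c.
  by rewrite mcoeff_msupp; apply: contraNneq cm => ->; rewrite mul0rn.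
by move=> /msize_mdeg_lt; rewrite mdegD mdeg1 addn1.
Qed.

Lemma divides_deriv_eq0 (c : C) v : divides c c^`M(v) -> c^`M(v) = 0.
Proof.
have [->|c0] := eqVneq c 0; first by rewrite mderiv0.
move=> [a Ea]; have [a0|a0] := eqVneq a 0; first by rewrite Ea a0 mul0r.
have := msize_deriv_lt v c0; rewrite Ea msizeM // ltnNge.
have : (0 < msize a)%N by rewrite lt0n msize_poly_eq0.
by case: (msize a) => // s _; rewrite addSn /= leq_addl.
Qed.

Lemma divides_poly_deriv (p : {poly C}) : divides p p^`() -> exists c, p = c%:P.
Proof.
have [->|p0] := eqVneq p 0; first by exists 0; rewrite polyC0.
move=> [a Ea]; have dp0 : p^`() = 0.
  have [a0|a0] := eqVneq a 0; first by rewrite Ea a0 mul0r.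
  have := lt_size_deriv p0; rewrite Ea size_mul // ltnNge.
  have : (0 < size a)%N by rewrite size_poly_gt0.
  by case: (size a) => // s _; rewrite addSn /= leq_addl.
exists p`_0; apply: size1_polyC; apply/leq_sizeP => -[//|k] _.
by apply: (@mpoly_mulrn_eq0 _ k); rewrite -coef_deriv dp0 coef0.
Qed.

Lemma msupp_deriv_eq0 (c : C) v m : c^`M(v) = 0 -> m \in msupp c -> m v = 0%N.
Proof.
move=> dc0; rewrite mcoeff_msupp; apply: contraNeq => mv.
have Em : (m - U_(v) + U_(v) = m)%MM by rewrite submK // lep1mP.
have := mcoeff_deriv v (m - U_(v))%MM c; rewrite dc0 mcoeff0 Em.
move/esym/eqP; rewrite mulrn_eq0 /= => /eqP ->; exact: eqxx.
Qed.

End MpolyDivides.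

Section Descent.
Variables (K : numFieldType) (n e : nat).
Local Notation N := (n.+1 * e.+1)%N.
Local Notation C := {mpoly K[N]}.
Local Notation B := {poly C}.

Lemma straighten_divides (u w : B) :
  divides u w -> divides (straighten u) (straighten w).
Proof. by move=> [c ->]; exists (straighten c); rewrite /straighten substM. Qed.

(** After straightening, [w] divides its derivatives in ['X] and in every [coef_var j k] with
    [k > 0]; a nonzero derivative would have smaller degree, so they all vanish. Only the
    [coef_var j ord0] remain, and [unstraighten] turns them into the coordinates of the point of the
    curve. *)
Lemma pull_descent (w : B) : (forall j l, divides w (slide j l w)) ->
  divides w (shift w) -> exists p : {mpoly K[n.+1]}, w = pull e p.
Proof.
move=> dvdw dvds.
have := straighten_divides (shift_to0_divides dvdw dvds).
rewrite straighten_shift_to0 => /divides_poly_deriv[c Ec].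
have dc j l : c^`M(mxvec_index j (lift ord0 l)) = 0.
  apply: divides_deriv_eq0.
  have := straighten_divides (slide_to0_divides (lift ord0 l) (dvdw j)).
  rewrite straighten_slide_to0 Ec cderivC => -[a /(congr1 (coefp 0%N)) /=].
  by rewrite coefMC !coefC eqxx => Ea; exists a`_0.
(* Renames [coef_var j ord0] to ['X_j]; the other variables do not occur in [c], so their value 0 is
   only a default. *)
pose pr : 'I_N -> {mpoly K[n.+1]} :=
  mxvec (\matrix_(j < n.+1, k < e.+1) if k == ord0 then 'X_j else 0) 0.
exists (mmap (@mpolyC n.+1 K) pr c).
rewrite -(straightenK w) Ec /unstraighten subst_polyC /subst_coef.
rewrite /mmap pull_sum /= big_seq [RHS]big_seq; apply: eq_bigr => m mc.
rewrite pullM pullC; congr (_ * _).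
rewrite /mmap1 pull_prod; apply: eq_bigr => v _; rewrite pullXn.
elim/mxvec_index_ind: v => j k; rewrite /subst_var /pr !mxvecE !mxE.
case: (eqVneq k ord0) => [_|]; first by rewrite pullX.
case: (unliftP ord0 k) => [l ->|-> /eqP //] _.
by rewrite (msupp_deriv_eq0 (dc j l) mc) !expr0.
Qed.

Lemma pihomog_top_neq0 m (p : {mpoly K[m]}) :
  p != 0 -> pihomog mdeg (msize p).-1 p != 0.
Proof.
move=> p0; set d := (msize p).-1.
have Ed : mdeg (mlead p) = d by rewrite /d -mlead_deg.
have: (pihomog mdeg d p)@_(mlead p) = p@_(mlead p).
  rewrite pihomogE raddf_sum /= big_mkcond (bigD1_seq (mlead p)) //=; last exact: mlead_supp.
  rewrite Ed eqxx mcoeffZ mcoeffX eqxx mulr1 big1 ?addr0 // => t /negPf tp.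
  by rewrite mcoeffZ mcoeffX tp mulr0 if_same.
move=> E; apply: contraNneq p0 => E0; move: E; rewrite E0 mcoeff0 => /esym/eqP.
by rewrite mleadc_eq0.
Qed.

(* Specializing the curve to [t |-> t ^ e * x] for a point [x] at which the
   leading form of [p] does not vanish. *)
Lemma size_pull (p : {mpoly K[n.+1]}) :
  (0 < e)%N -> p != 0 -> (e * (msize p).-1 < size (pull e p))%N.
Proof.
move=> e0 p0; set d := (msize p).-1.
have [x x0] := exists_mnonroot (pihomog_top_neq0 p0).
pose psi := meval (mxvec (\matrix_(j < n.+1, k < e.+1)
  if k == ord_max then x j else 0) 0).
have psi_curve j : map_poly psi (generic_curve K e j) = (x j)%:P * 'X^e.
  rewrite /generic_curve rmorph_sum /= (bigD1 ord_max) //= big1 => [|k nk].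
    rewrite addr0 rmorphM /= map_polyXn map_polyC /psi /= mevalXU.
    by rewrite mxvecE mxE eqxx.
  rewrite rmorphM /= map_polyC /psi /= mevalXU mxvecE mxE (negPf nk).
  by rewrite mul0r.
have Emap : map_poly psi (pull e p) =
    \sum_(m <- msupp p) (p@_m * \prod_j x j ^+ m j) *: 'X^(e * mdeg m).
  rewrite /pull /mmap rmorph_sum; apply: eq_bigr => m _ /=.
  rewrite rmorphM /= map_polyC /psi /= mevalC -mul_polyC polyCM -mulrA -/psi.
  congr (_ * _); rewrite /mmap1 rmorph_prod /=.
  under eq_bigr => j _ do rewrite rmorphXn /= psi_curve exprMn -exprM.
  rewrite big_split /= rmorph_prod /=; congr (_ * _).
    by apply: eq_bigr => j _; rewrite rmorphXn.
  by rewrite prodrXr mdegE big_distrr.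
apply: leq_trans (_ : size (map_poly psi (pull e p)) <= _)%N; last exact: size_poly.
rewrite ltnNge; apply: contra x0 => /leq_sizeP/(_ (e * d)%N (leqnn _)).
rewrite Emap coef_sum pihomogE raddf_sum /= => E; rewrite -[X in _ == X]E.
apply/eqP; rewrite big_mkcond; apply: eq_bigr => m _.
rewrite coefZ coefXn eqn_pmul2l // eq_sym.
case: eqP => _; last by rewrite mulr0.
by rewrite mevalZ mevalX mulr1.
Qed.

End Descent.

(** * Syzygies on the generic curve *)

Lemma row_free_col_mx (F : fieldType) r m (A : 'M[F]_(r, m)) (v : 'rV_m) :
  row_free A -> ~~ (v <= A)%MS -> row_free (col_mx A v).
Proof.
move=> fA nvA; rewrite /row_free -addsmxE eqn_leq.
have rA : \rank A = r by apply/eqP.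
have ltr : (r < \rank (A + v)%MS)%N.
  rewrite -[X in (X < _)%N]rA (ltn_leqif (mxrank_leqif_sup (addsmxSl A v))).
  by rewrite addsmx_sub submx_refl.
have ub : (\rank (A + v)%MS <= r + 1)%N.
  by apply: leq_trans (mxrank_adds_leqif A v) _; rewrite rA leq_add2l rank_leq_row.
by rewrite ub addn1.
Qed.

Section Minors.
Variables (B : idomainType) (r m : nat) (M : 'M[B]_(r, m)).

(** The Pluecker coordinates of the row span. The map [f] is arbitrary, possibly with repetitions,
    so that a single column index can run freely. *)
Definition minor (f : {ffun 'I_r -> 'I_m}) : B := \det (colsub f M).

Local Notation Mf := (map_mx (@tofrac B) M).

Lemma exists_minor_neq0 : row_free Mf -> exists f, minor f != 0.
Proof.
move=> fM; have fT : row_full (Mf^T) by rewrite /row_full mxrank_tr.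
exists [ffun i => fullrankfun fT i]; rewrite -tofrac_eq0 /minor -det_map_mx.
have := fullrowsub_unit fT; rewrite unitmxE unitfE -det_tr.
congr (\det _ != 0); apply/matrixP => i j.
by rewrite !mxE [in RHS]ffunE.
Qed.

(** Over the fraction field the derivative of [M] is [Q *m M], so by Jacobi's formula [D] multiplies
    every maximal minor by the same factor [\tr Q]. *)
Lemma minor_derivation (D : B -> B) f g : derivation D ->
  (map_mx (@tofrac B) (map_mx D M) <= Mf)%MS ->
  minor f * D (minor g) = minor g * D (minor f).
Proof.
move=> der /submxP[Q EQ].
have E h : tofrac (D (minor h)) = \tr Q * tofrac (minor h).
  rewrite /minor (derivation_det _ der) -trace_map_mx map_mxM map_mx_adj.
  have -> : map_mx (@tofrac B) (map_mx D (colsub h M)) =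
            Q *m map_mx (@tofrac B) (colsub h M).
    apply/matrixP => i j; have /matrixP/(_ i (h j)) := EQ; rewrite !mxE => ->.
    by apply: eq_bigr => l _; rewrite !mxE.
  rewrite -mulmxA mul_mx_adj mul_mx_scalar linearZ /= mulrC det_map_mx.
  by [].
apply/eqP; rewrite -tofrac_eq !tofracM !E; apply/eqP; ring.
Qed.

(** Expanding along column [l] makes the sum a combination, with cofactors as coefficients, of the
    syzygies given by the rows. *)
Lemma minor_syzygy (P : 'I_m -> B) (l : 'I_r) (f : 'I_r -> 'I_m) :
  (forall k, \sum_j P j * M k j = 0) ->
  \sum_j P j * minor [ffun i => if i == l then j else f i] = 0.
Proof.
move=> syz.
have E j : minor [ffun i => if i == l then j else f i] =
    \sum_k M k j * cofactor (colsub f M) k l.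
  rewrite /minor (expand_det_col _ l); apply: eq_bigr => k _.
  rewrite !mxE ffunE eqxx; congr (_ * _); rewrite /cofactor; congr (_ * \det _).
  apply/matrixP => s t; rewrite !mxE ffunE; case: eqP => // Et.
  by have := neq_lift l t; rewrite Et eqxx.
under eq_bigr => j _ do rewrite E mulr_sumr.
rewrite exchange_big big1 //= => k _.
under eq_bigr => j _ do rewrite mulrA.
by rewrite -mulr_suml syz mul0r.
Qed.

End Minors.

Section Chain.
Variables (C : idomainType) (m : nat).
Local Notation B := {poly C}.
Variables (P : 'I_m -> B) (e : nat) (DD : (B -> B) -> Prop).
Hypothesis (P0 : exists j, P j != 0).
Hypothesis derDD : forall D, DD D -> derivation D.
Hypothesis DD0 : forall D j, DD D -> D (P j) = 0.
Hypothesis sizeDD : forall D p, DD D -> (size (D p) <= (size p).+1)%N.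

(** The degree [e + k] allowed in row [k] grows with [k], so that the derivative of any row can be
    appended as a new last row. *)
Definition syzygy_chain r (M : 'M[B]_(r, m)) :=
  [/\ forall k, \sum_j P j * M k j = 0,
      forall k j, (size (M k j) <= (e + k).+1)%N &
      row_free (map_mx (@tofrac B) M)].

(** The rows are independent and all orthogonal to the nonzero column of the [P j]. *)
Lemma syzygy_chain_bound r (M : 'M[B]_(r, m)) : syzygy_chain M -> (r < m)%N.
Proof.
move=> [syz _ fM]; have [j0 Pj0] := P0.
pose c := \col_j tofrac (P j).
have Mc : map_mx (@tofrac B) M *m c = 0.
  apply/matrixP => k l; rewrite !mxE.
  under eq_bigr => j _ do rewrite !mxE -tofracM mulrC.
  by rewrite -(rmorph_sum (@tofrac B)) /= syz tofrac0.
have c0 : c != 0.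
  apply: contraNneq Pj0 => /matrixP/(_ j0 0); rewrite !mxE => /eqP.
  by rewrite tofrac_eq0.
have := mulmx0_rank_max Mc; have /eqP -> : \rank (map_mx (@tofrac B) M) == r by [].
have : (0 < \rank c)%N by rewrite lt0n mxrank_eq0.
by move=> c1; apply: leq_trans; rewrite -addn1 leq_add2l.
Qed.

(* A vector field of [DD] maps syzygies to syzygies and raises degrees by at
   most one, so it preserves the span of a chain of maximal length. *)
Lemma maximal_syzygy_chain (g : 'rV[B]_m) : g != 0 ->
  \sum_j P j * g 0 j = 0 -> (forall j, (size (g 0%R j) <= e.+1)%N) ->
  exists r (M : 'M[B]_(r, m)), [/\ (0 < r)%N, syzygy_chain M &
    forall D, DD D ->
      (map_mx (@tofrac B) (map_mx D M) <= map_mx (@tofrac B) M)%MS].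
Proof.
move=> g0 syzg sg; pose Q r := `[< exists M : 'M[B]_(r, m), syzygy_chain M >].
have Q1 : Q 1%N.
  apply/asboolP; exists g; split=> [k|k j|].
  - by rewrite (ord1 k).
  - by rewrite !ord1 addn0.
  - rewrite /row_free eqn_leq rank_leq_row lt0n mxrank_eq0.
    apply: contra g0 => /eqP/matrixP g0; apply/eqP/matrixP => i j.
    by have /eqP := g0 i j; rewrite !mxE tofrac_eq0 => /eqP.
have Qm r : Q r -> (r <= m)%N.
  by move=> /asboolP[M /syzygy_chain_bound /ltnW].
have exQ : exists r, Q r by exists 1%N.
have [r /asboolP[M chM] maxr] := ex_maxnP exQ Qm.
exists r, M; split=> [|//|D DDD]; first exact: maxr Q1.
have [DA DM] := derDD DDD; have D0 := derivation_along0 (derDD DDD).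
apply/row_subP => k; apply: contrapT => /negP nsub.
suff /maxr : Q r.+1 by rewrite ltnn.
rewrite -addn1; apply/asboolP; exists (col_mx M (row k (map_mx D M))).
have [syz sM fM] := chM.
split=> [i|i j|].
- case: (split_ordP i) => s ->.
    by under eq_bigr => j _ do rewrite col_mxEu; exact: syz.
  under eq_bigr => j _ do rewrite col_mxEd !mxE.
  have := congr1 D (syz k); rewrite D0 (derivation_along_sum _ _ _ (derDD DDD)).
  move=> E; rewrite -[RHS]E.
  by apply: eq_bigr => j _; rewrite DM DD0 // mul0r add0r.
- case: (split_ordP i) => s ->; first by rewrite col_mxEu; exact: sM.
  rewrite col_mxEd !mxE (leq_trans (sizeDD _ DDD)) // ltnS.
  rewrite (leq_trans (sM k j)) // (ord1 s) /= addn0.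
  by rewrite -addnS leq_add2l ltn_ord.
- rewrite map_col_mx; apply: row_free_col_mx => //.
  by rewrite map_row; apply: nsub.
Qed.

Lemma size_minor_chain r (M : 'M[B]_(r, m)) f :
  syzygy_chain M -> (size (minor M f) <= (\sum_(k < r) (e + k)).+1)%N.
Proof.
move=> [_ sM _]; rewrite /minor /determinant.
apply: leq_trans (size_sum _ _ _) _; apply/bigmax_leqP => s _.
rewrite size_Msign; apply: leq_trans (size_prod_leq _ _) _.
rewrite leq_subLR cardT size_enum_ord addnS ltnS.
rewrite -[X in (X + _)%N]muln1 -[X in (X * _)%N]card_ord -sum_nat_const -big_split /=.
by apply: leq_sum => k _; rewrite mxE add1n.
Qed.

End Chain.

Section GenericSyzygy.
Variables (K : numClosedFieldType) (n e : nat).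
Local Notation N := (n.+1 * e.+1)%N.
Local Notation C := {mpoly K[N]}.
Local Notation B := {poly C}.

Inductive flow : (B -> B) -> Prop :=
  | Slide j l : flow (slide j l)
  | Shift : flow (@shift K n e).

(** Homogeneous parts of a syzygy of forms of equal degree are syzygies; [msize (h j) <= D] says
    that only degrees below [D] occur. *)
Lemma syzygy_msize_eq0 D (P h : 'I_n.+1 -> {mpoly K[n.+1]}) :
  (forall j, P j \is D.-homog) ->
  (forall x : 'I_n.+1 -> K, (exists k, x k != 0) -> exists j, (P j).@[x] != 0) ->
  (forall j, (msize (h j) <= D)%N) -> \sum_j h j * P j = 0 -> forall j, h j = 0.
Proof.
move=> hP noz sh h0 j; rewrite [h j](pihomog_partitionE (sh j)).
apply: big1 => q _.
apply: (no_low_degree_syzygy (h := fun j => pihomog mdeg q (h j)) hP noz (ltn_ord q)).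
  by move=> i; apply: pihomogP.
have := congr1 (pihomog mdeg (q + D)) h0; rewrite raddf0 raddf_sum /= => E.
rewrite -[RHS]E; apply: eq_bigr => i _.
by rewrite (pihomogM _ _ (hP i)) /twist_part leq_addl addnK.
Qed.

Theorem no_generic_syzygy D (P : 'I_n.+1 -> {mpoly K[n.+1]}) (g : 'rV[B]_n.+1) :
  (forall j, P j \is D.-homog) ->
  (forall x : 'I_n.+1 -> K, (exists k, x k != 0) -> exists j, (P j).@[x] != 0) ->
  (0 < e)%N -> (\sum_(k < n) (e + k) < e * D)%N ->
  (forall j, (size (g 0%R j) <= e.+1)%N) -> \sum_j pull e (P j) * g 0 j = 0 -> g = 0.
Proof.
move=> hP noz e0 num sg syzg; apply/eqP; apply: contrapT => /negP g0.
have P0 : exists j, pull e (P j) != 0.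
  have [|j Pj] := noz (fun=> 1); first by exists ord0; rewrite oner_neq0.
  exists j; rewrite -size_poly_eq0 -lt0n.
  have Pj0 : P j != 0 by apply: contraNneq Pj => ->; rewrite meval0.
  exact: leq_ltn_trans (leq0n _) (size_pull e0 Pj0).
have derflow D' : flow D' -> derivation D'.
  by case=> [j l|]; [exact: derivation_slide | exact: derivation_shift].
have flow0 D' j : flow D' -> D' (pull e (P j)) = 0.
  case=> [j' l|]; apply: pull_derivation0.
  - exact: derivation_slide.
  - exact: slide_const.
  - exact: slide_curve.
  - exact: derivation_shift.
  - exact: shift_const.
  - exact: shift_curve.
have sizeflow D' p : flow D' -> (size (D' p) <= (size p).+1)%N.
  by case=> [j l|]; [exact: size_slide | exact: leqW (size_shift p)].
have [r [M [r0 chM flowM]]] :=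
  maximal_syzygy_chain P0 derflow flow0 sizeflow g0 syzg sg.
have [syzM _ fM] := chM.
have rn : (r <= n)%N := syzygy_chain_bound P0 chM.
have [f0 Gf0] := exists_minor_neq0 fM.
have ufdB : ufd B by apply: ufd_poly; apply: ufd_mpoly.
have [h [Om [h0 EG prOm]]] := primitive_part ufdB Gf0.
(* Once [h] is cancelled, [minor_derivation] reads [Om f' * D' (Om f) = Om f * D' (Om f')] for all
   [f']; primitivity then removes the factor [Om f']. *)
have flowOm D' f : flow D' -> divides (Om f) (D' (Om f)).
  move=> flD; have der := derflow D' flD; have [DA DM] := der.
  have [->|Omf] := eqVneq (Om f) 0.
    by rewrite (derivation_along0 der); apply: divides0.
  apply: (primitive_divides ufdB prOm Omf) => f'.
  exists (D' (Om f')); apply: (mulfI h0); apply: (mulfI h0).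
  have := minor_derivation f' f der (flowM D' flD); rewrite !EG !DM => E.
  apply: (addrI (h * Om f' * (D' h * Om f))).
  rewrite (_ : _ + _ = h * Om f' * (D' h * Om f + h * D' (Om f))); last by ring.
  by rewrite E; ring.
have /choice[om Eom] : forall f, exists p, Om f = pull e p.
  move=> f; apply: pull_descent => [j l|]; apply: flowOm; first exact: Slide.
  exact: Shift.
(* Degrees in ['X] are compared: at least [e] times the degree of [om f] by [size_pull], at most the
   sum of the degrees allowed to the rows of the chain. *)
have som f : (msize (om f) <= D)%N.
  have [->|omf] := eqVneq (om f) 0; first by rewrite msize0.
  have pomf : pull e (om f) != 0.
    rewrite -size_poly_gt0; exact: leq_ltn_trans (leq0n _) (size_pull e0 omf).
  have s1 := size_pull e0 omf.
  have s2 : (size (pull e (om f)) <= size (minor M f))%N.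
    rewrite EG Eom size_mul // -subn1 leq_subRL ?addn_gt0 ?size_poly_gt0 ?h0 //.
    by rewrite leq_add2r size_poly_gt0.
  have s3 := size_minor_chain f chM.
  have s4 : (\sum_(k < r) (e + k) <= \sum_(k < n) (e + k))%N.
    rewrite -!(big_mkord xpredT (fun k => e + k)%N).
    by rewrite [X in (_ <= X)%N](big_cat_nat (n := r)) //= leq_addr.
  have : (e * (msize (om f)).-1 < e * D)%N.
    apply: leq_ltn_trans num; rewrite -ltnS.
    by apply: leq_trans s1 _; apply: leq_trans s2 _; apply: leq_trans s3 _.
  by rewrite ltn_pmul2l // prednK ?lt0n ?msize_poly_eq0.
have l0 : 'I_r := Ordinal r0.
(* Letting the column index at [l0] vary gives a syzygy of the pulled back [P j]; it is one of the
   [P j] themselves, because [pull] is injective by [size_pull]. *)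
have om0 f : om f = 0.
  pose f' j := [ffun i => if i == l0 then j else f i] : {ffun 'I_r -> 'I_n.+1}.
  have Ef : f = f' (f l0).
    by apply/ffunP => i; rewrite ffunE; case: eqP => [->|].
  rewrite Ef; apply: (syzygy_msize_eq0 (h := fun j => om (f' j)) hP noz) => //.
  apply/eqP; apply: contrapT => /negP nz.
  have /eqP := minor_syzygy l0 f syzM.
  under eq_bigr => j _ do rewrite EG Eom mulrCA mulrC -pullM mulrC.
  rewrite -mulr_sumr -pull_sum mulf_eq0 (negPf h0) /= -size_poly_eq0.
  under eq_bigr => j _ do rewrite mulrC.
  by rewrite -leqn0 leqNgt (leq_ltn_trans (leq0n _) (size_pull e0 nz)).
by case/eqP: Gf0; rewrite EG Eom om0 /pull rmorph0 mulr0.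
Qed.

End GenericSyzygy.

(** * Dimension of projective images *)

Lemma exists_left_kernel (K : fieldType) m p (A : 'M[K]_(m, p)) : (p < m)%N ->
  exists2 w : 'rV_m, w != 0 & w *m A = 0.
Proof.
move=> ltpm; have : kermx A != 0.
  by rewrite -mxrank_eq0 mxrank_ker subn_eq0 -ltnNge (leq_ltn_trans (rank_leq_col A)).
case/rowV0Pn => w /sub_kermxP wA w0; by exists w.
Qed.

Section Dimension.
Variables (K : fieldType) (N : nat).

(** A dimension count: the [q ^ m] products [Q a] are forms of degree [D] in [N.+1] variables, which
    span a space of dimension at most [(D + 1) ^ N]. A linear relation between them is a polynomial
    relation between the quotients. *)
Lemma exists_dependency m k (h : {mpoly K[N.+1]}) (g : 'I_m -> {mpoly K[N.+1]}) :
  h \is k.-homog -> (forall i, g i \is k.-homog) -> (N < m)%N ->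
  exists2 P : {mpoly K[m]}, P != 0 &
    forall x : 'I_N.+1 -> K, h.@[x] != 0 -> P.@[fun i => (g i).@[x] / h.@[x]] = 0.
Proof.
(* With this [q], [D + 1 <= (k * m + 2) * q], so [(D + 1) ^ N <= (k * m + 2) ^ N * q ^ N < q ^ N.+1
   <= q ^ m]. *)
move=> hh hg ltNm; pose q := ((k * m + 2) ^ N.+1)%N; pose L := (m * q)%N.
have q0 : (0 < q)%N by rewrite expn_gt0 addn2.
pose D := (k * L)%N; pose rows := {ffun 'I_m -> 'I_q}.
pose cols := {ffun 'I_N -> 'I_D.+1}.
have card_lt : (#|{: cols}| < #|{: rows}|)%N.
  rewrite !card_ffun !card_ord; apply: (@leq_trans (q ^ N.+1)%N); last first.
    by rewrite leq_pexp2l.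
  apply: (@leq_ltn_trans (((k * m + 2) * q) ^ N)%N).
    have [->|N0] := posnP N; first by rewrite !expn0.
    by rewrite leq_exp2r // /D /L; nia.
  rewrite expnMn [X in (_ < X)%N]expnS ltn_pmul2r; last by rewrite expn_gt0 q0.
  by rewrite /q ltn_exp2l // addn2.
pose Q (a : rows) : {mpoly K[N.+1]} :=
  (\prod_i g i ^+ a i) * h ^+ (L - \sum_i a i).
have leaL (a : rows) : (\sum_i a i <= L)%N.
  rewrite /L -[m in X in (_ <= X)%N]card_ord -sum_nat_const.
  by apply: leq_sum => i _; apply: ltnW.
have hQ a : Q a \is D.-homog.
  have hp : \prod_i g i ^+ a i \is (k * \sum_i a i).-homog.
    rewrite big_distrr /=.
    apply: (@big_rec2 _ _ (fun (d : nat) (p : {mpoly K[N.+1]}) => p \is d.-homog)).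
      exact: dhomog1.
    by move=> i d p _ hp; rewrite dhomogM // dhomogMn.
  have -> : D = (k * \sum_i a i + k * (L - \sum_i a i))%N.
    by rewrite -mulnDr subnKC.
  by rewrite dhomogM // dhomogMn.
(* A monomial of degree [D] is determined by its first [N] exponents; columns whose exponents
   already exceed [D] in total are zero. *)
pose mon (b : cols) : 'X_{1..N.+1} :=
  [multinom oapp (fun j => b j : nat) (D - \sum_j b j)%N (unlift ord_max i) | i < N.+1].
pose A := \matrix_(a < #|{: rows}|, b < #|{: cols}|)
  (Q (enum_val a))@_(mon (enum_val b)).
have [w w0 wA] := exists_left_kernel A card_lt.
pose mrow (a : rows) : 'X_{1..m} := [multinom (a i : nat) | i < m].
have mrow_inj : injective mrow.
  move=> a a' E; apply/ffunP => i; apply: val_inj.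
  by have := congr1 (fun t : 'X_{1..m} => t i) E; rewrite !mnmE.
exists (\sum_a w 0 a *: 'X_[mrow (enum_val a)]).
  apply: contraNneq w0 => E; apply/eqP/rowP => a; rewrite [RHS]mxE.
  have := congr1 (mcoeff (mrow (enum_val a))) E.
  rewrite mcoeff0 raddf_sum /= (bigD1 a) //= mcoeffZ mcoeffX eqxx mulr1.
  rewrite big1 ?addr0 // => a' na'; rewrite mcoeffZ mcoeffX.
  case: eqP => [/mrow_inj/enum_val_inj Ea|_]; last by rewrite mulr0.
  by rewrite Ea eqxx in na'.
have Q0 : \sum_a w 0 a *: Q (enum_val a) = 0.
  apply/mpolyP => t; rewrite mcoeff0.
  have hS : \sum_a w 0 a *: Q (enum_val a) \is D.-homog.
    by apply: rpred_sum => a _; apply: rpredZ.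
  have [Et|nt] := eqVneq (mdeg t) D; last exact: (dhomog_nemf_coeff hS nt).
  have tD j : (t (lift ord_max j) < D.+1)%N.
    rewrite ltnS -Et mdegE (bigD1 (lift ord_max j)) //=; exact: leq_addr.
  pose b : cols := [ffun j => Ordinal (tD j)].
  have -> : t = mon b.
    apply/mnmP => i; rewrite mnmE; case: unliftP => [j ->|->] /=.
      by rewrite ffunE.
    have -> : (\sum_j b j = \sum_(j < N) t (lift ord_max j))%N.
      by apply: eq_bigr => j _; rewrite ffunE.
    by rewrite -Et mdegE (bigD1_ord ord_max) //= addnK.
  have := congr1 (fun v : 'rV_#|{: cols}| => v 0 (enum_rank b)) wA.
  rewrite !mxE raddf_sum /= => E; rewrite -[RHS]E; apply: eq_bigr => a _.
  by rewrite mcoeffZ mxE enum_rankK.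
move=> x hx; apply: (mulfI (expf_neq0 L hx)); rewrite mulr0.
have := congr1 (meval x) Q0; rewrite meval0 !raddf_sum /= => E.
rewrite -[RHS]E mulr_sumr; apply: eq_bigr => a _.
rewrite !mevalZ mulrCA; congr (_ * _); rewrite mevalX mevalM rmorph_prod /=.
rewrite rmorphXn /= -{1}(subnKC (leaL (enum_val a))) exprD mulrAC; congr (_ * _).
rewrite expr_sum -big_split /=; apply: eq_bigr => i _.
by rewrite rmorphXn /= mnmE expr_div_n mulrCA mulfV ?mulr1 // expf_neq0.
Qed.

Lemma indep_functions_lt (S : 'rV[K]_N.+1 -> Prop) m :
  has_indep_functions S m -> (m <= N)%N.
Proof.
move=> [k [h [g [hh hg indep]]]]; rewrite leqNgt; apply/negP => ltNm.
have [P P0 PE] := exists_dependency hh hg ltNm.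
by have [x [_ hx /eqP]] := indep P P0; apply; apply: PE.
Qed.

End Dimension.

Section Homogenization.
Variables (K : fieldType) (m : nat) (P : {mpoly K[m]}).

(** The target degree [msize P] is one more than the degree of a nonzero [P]; the extra factor
    ['X_ord0] is harmless, as only points where that coordinate is nonzero are used. *)
Definition homogenization : {mpoly K[m.+1]} :=
  \sum_(t <- msupp P) P@_t *:
    (\prod_i 'X_(lift ord0 i) ^+ t i * 'X_ord0 ^+ (msize P - mdeg t)).

Lemma homogenization_neq0 : P != 0 -> homogenization != 0.
Proof.
apply: contraNneq => H0; apply/eqP.
pose s (i : 'I_m.+1) : {mpoly K[m]} := oapp (fun j => 'X_j) 1 (unlift ord0 i).
have := congr1 (mmap (@mpolyC m K) s) H0; rewrite rmorph0 => E.
rewrite -[RHS]E [LHS]mpolyE rmorph_sum; apply: eq_bigr => t _ /=.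
rewrite mmapZ -mul_mpolyC rmorphM rmorph_prod rmorphXn /= mmapX mmap1U.
rewrite /s unlift_none expr1n mulr1 mpolyXE_id; congr (_ * _).
by apply: eq_bigr => i _; rewrite rmorphXn /= mmapX mmap1U liftK.
Qed.

Lemma meval_homogenization (y : 'I_m.+1 -> K) : y ord0 != 0 ->
  homogenization.@[y] =
  y ord0 ^+ msize P * P.@[fun i => y (lift ord0 i) / y ord0].
Proof.
move=> y0; rewrite /homogenization raddf_sum mevalE mulr_sumr /= !big_seq.
apply: eq_bigr => t tP; rewrite mevalZ mulrCA; congr (_ * _).
rewrite mevalM rmorph_prod rmorphXn /= mevalXU.
have lt : (mdeg t <= msize P)%N by apply/ltnW/msize_mdeg_lt.
rewrite -{2}(subnK lt) exprD -mulrA mulrC; congr (_ * _).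
rewrite mdegE expr_sum -big_split /=; apply: eq_bigr => i _.
by rewrite rmorphXn /= mevalXU expr_div_n mulrCA mulfV ?mulr1 // expf_neq0.
Qed.

End Homogenization.

(** The functions are the ratios of the chosen coordinates to the first one: a relation between
    them, homogenized and multiplied by ['X_ord0], would be a relation between the coordinates. *)
Lemma has_indep_coordinates (K : fieldType) M m (S : 'rV[K]_M -> Prop)
    (c : 'I_m.+1 -> 'I_M) :
  (forall R : {mpoly K[m.+1]}, R != 0 ->
     exists2 x, S x & R.@[fun i => x 0 (c i)] != 0) ->
  has_indep_functions S m.
Proof.
move=> dense; exists 1%N, 'X_(c ord0), (fun i => 'X_(c (lift ord0 i))); split.
- by rewrite dhomogX /= mdeg1.
- by move=> i; rewrite dhomogX /= mdeg1.
move=> P P0; have [|x Sx] := dense ('X_ord0 * homogenization P).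
  rewrite mulf_neq0 ?homogenization_neq0 //.
  by rewrite -msize_poly_eq0 msizeX.
rewrite mevalM mevalXU mulf_eq0 negb_or => /andP[x0 Hx].
exists x; rewrite /meval_row mevalXU; split=> //.
move: Hx; rewrite meval_homogenization // mulf_eq0 negb_or => /andP[_].
apply: contraNneq => E; apply/eqP; rewrite -[RHS]E; apply: meval_eq => i.
by rewrite mevalXU.
Qed.

(** * Curve sections *)

Lemma tofrac_denom (R : idomainType) (x : {fraction R}) :
  exists a b, b != 0 /\ tofrac b * x = tofrac a.
Proof.
exists \n_(repr x), \d_(repr x); split; first exact: denom_ratioP.
have d0 := denom_ratioP (repr x).
rewrite -[X in _ * X]reprK !piE.
apply/eqmodP; rewrite /= FracField.equivfE /FracField.mulf.
by rewrite !numden_Ratio ?oner_eq0 ?mulf_neq0 ?oner_eq0 //; apply/eqP;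
   rewrite mul1r mulr1 mulrC.
Qed.

(** Denominators are cleared in a kernel vector over the fraction field. *)
Lemma row_free_tofrac (R : idomainType) m p (M : 'M[R]_(m, p)) :
  (forall w : 'rV_m, w *m M = 0 -> w = 0) -> row_free (map_mx (@tofrac R) M).
Proof.
move=> injM; rewrite -kermx_eq0; apply/eqP/row_matrixP => i; rewrite row0.
set x := row i _; have xM : x *m map_mx (@tofrac R) M = 0.
  by rewrite /x -row_mul mulmx_ker row0.
have /choice[a /choice[b /all_and2[b0 Eab]]] := fun j => tofrac_denom (x 0 j).
pose s := \prod_j b j; have s0 : s != 0 by apply/prodf_neq0.
pose w := \row_j (a j * \prod_(l | l != j) b l).
have Ew : map_mx (@tofrac R) w = tofrac s *: x.
  apply/rowP => j; rewrite [LHS]mxE [RHS]mxE [w 0 j]mxE.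
  have -> : s = b j * \prod_(l | l != j) b l by rewrite /s (bigD1 j).
  by rewrite !rmorphM /= -(Eab j) mulrAC.
have /injM w0 : w *m M = 0.
  apply/rowP => j; apply/eqP; rewrite [X in _ == X]mxE -tofrac_eq0; apply/eqP.
  transitivity ((map_mx (@tofrac R) w *m map_mx (@tofrac R) M) 0 j).
    by rewrite -map_mxM !mxE.
  by rewrite Ew -scalemxAl xM scaler0 mxE.
move: Ew; rewrite w0 map_mx0 => /esym/eqP.
by rewrite scaler_eq0 tofrac_eq0 (negPf s0) /= => /eqP.
Qed.

(** Differentiating a relation [R] of least degree gives a linear relation between the gradients of
    the [phi i]. So each partial derivative of [R] is a relation too, hence zero by minimality, and
    in characteristic zero [R] is constant. *)
Lemma jacobian_criterion (K : numFieldType) M N (phi : 'I_M -> {mpoly K[N]}) :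
  (forall w : 'rV[{mpoly K[N]}]_M,
     (forall v, \sum_i w 0 i * (phi i)^`M(v) = 0) -> w = 0) ->
  forall R : {mpoly K[M]}, R != 0 -> mmap (@mpolyC N K) phi R != 0.
Proof.
move=> jac R; have [s] := ubnP (msize R); elim: s => // s IHs in R *.
rewrite ltnS => sR R0; apply/negP => /eqP E0.
have dR i : R^`M(i) = 0.
  apply/eqP; apply: contrapT => /negP dR0.
  pose w := \row_i mmap (@mpolyC N K) phi R^`M(i).
  suff /rowP/(_ i) : w = 0.
    rewrite !mxE => /eqP; apply/negP; apply: (IHs _ _ dR0).
    exact: leq_trans (msize_deriv_lt i R0) sR.
  apply: jac => v; have der : derivation (mderiv v : {mpoly K[N]} -> _).
    by split=> p q; rewrite ?mderivD ?mderivM.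
  have := derivation_mmap phi R der (mderivC v); rewrite E0 mderiv0 => E.
  by rewrite [RHS]E; apply: eq_bigr => j _; rewrite mxE.
have RC : R = (R@_0)%:MP.
  apply: msize1_polyC; rewrite msizeE; apply/bigmax_leqP_seq => t tR _.
  rewrite ltnS leqn0 mdeg_eq0; apply/eqP/mnmP => i; rewrite mnm0E.
  exact: msupp_deriv_eq0 (dR i) tR.
move: E0; rewrite RC mmapC => /(congr1 (mcoeff 0%MM)).
rewrite mcoeffC eqxx mulr1 mcoeff0 => R00.
by case/eqP: R0; rewrite RC R00 mpolyC0.
Qed.

Lemma mmap_homog (K : fieldType) m N c D (phi : 'I_m -> {mpoly K[N]})
    (p : {mpoly K[m]}) :
  p \is D.-homog -> (forall i, phi i \is c.-homog) ->
  mmap (@mpolyC N K) phi p \is (c * D).-homog.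
Proof.
move=> hp hphi; rewrite /mmap big_seq; apply: rpred_sum => u up.
rewrite mul_mpolyC; apply: rpredZ.
rewrite -(dhomog_mf hp up) /= mdegE big_distrr /=.
suff : \prod_(i < m) phi i ^+ u i \is [in K[N], (\sum_(i < m) c * u i).-homog].
  by [].
apply: (@big_rec2 _ _ (fun (d : nat) (q : {mpoly K[N]}) => q \is d.-homog)).
  exact: dhomog1.
by move=> i d q _ hq; rewrite dhomogM // dhomogMn.
Qed.

Lemma meval_mmap (K : fieldType) m N (phi : 'I_m -> {mpoly K[N]})
    (p : {mpoly K[m]}) (x : 'I_N -> K) :
  (mmap (@mpolyC N K) phi p).@[x] = p.@[fun i => (phi i).@[x]].
Proof.
elim/mpoly_ring_ind: p => [c|i|p q Hp Hq|p q Hp Hq].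
- by rewrite mmapC !mevalC.
- by rewrite mmapX mmap1U mevalXU.
- by rewrite rmorphD !mevalD; apply: (f_equal2 +%R Hp Hq).
- by rewrite rmorphM !mevalM; apply: (f_equal2 *%R Hp Hq).
Qed.

Section CurveSections.
Variables (K : numClosedFieldType) (n e d : nat).
Local Notation N := (n.+1 * e.+1)%N.
Local Notation C := {mpoly K[N]}.

Lemma meval_along_axis (p : C) (x : 'I_N -> K) v :
  p.@[x] != 0 -> exists2 q : {poly K}, q != 0 &
    forall z, q.[z] = p.@[fun i => x i + (i == v)%:R * z].
Proof.
move=> px; pose y i : {poly K} := (x i)%:P + (i == v)%:R * 'X.
have E z : (mmap polyC y p).[z] = p.@[fun i => x i + (i == v)%:R * z].
  elim/mpoly_ring_ind: p {px} => [c|i|p q Hp Hq|p q Hp Hq].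
  - by rewrite mmapC hornerC mevalC.
  - rewrite mmapX mmap1U mevalXU /y hornerD hornerC; congr (_ + _).
    by case: eqP => _; rewrite ?mul1r ?mul0r ?hornerX ?horner0.
  - by rewrite rmorphD hornerD mevalD; apply: (f_equal2 +%R Hp Hq).
  - by rewrite rmorphM hornerM mevalM; apply: (f_equal2 *%R Hp Hq).
exists (mmap polyC y p); last exact: E.
apply: contraNneq px => y0; have := E 0; rewrite y0 horner0 => ->.
by apply/eqP/meval_eq => i; rewrite mulr0 addr0.
Qed.

Lemma meval_binary_form D (c : 'rV[K]_D.+1) (s : 'rV[K]_2) :
  meval_row (binary_form c) s =
  \sum_(k < D.+1) c 0 k * (s 0 ord0 ^+ k * s 0 ord_max ^+ (D - k)).
Proof.
rewrite /meval_row /binary_form raddf_sum; apply: eq_bigr => k _ /=.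
rewrite mevalZ mevalX big_ord_recl big_ord1 !mnmE /=; congr (_ * (_ * s 0 _ ^+ _)).
exact: val_inj.
Qed.

(* A point where [p] and the leading coefficient of the second form do not
   vanish can be moved, changing only the constant coefficient of the first
   form, so that the first two forms have no common root. *)
Lemma Mor_dense (p : C) : (0 < n)%N -> p != 0 ->
  exists2 v : 'rV[K]_N, Mor v & p.@[fun i => v 0 i] != 0.
Proof.
move=> n0 p0; pose j1 : 'I_n.+1 := Ordinal (n0 : (1 < n.+1)%N).
pose v1 := mxvec_index j1 (ord_max : 'I_e.+1).
pose v0 := mxvec_index (ord0 : 'I_n.+1) (ord0 : 'I_e.+1).
have [|x] := @exists_mnonroot K N (p * 'X_v1).
  by rewrite mulf_neq0 // -msize_poly_eq0 msizeX.
rewrite mevalM mevalXU mulf_eq0 negb_or => /andP[px xv1].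
have [q q0 Eq] := meval_along_axis v0 px.
pose f j : {poly K} := \poly_(k < e.+1) x (mxvec_index j (inord k)).
have f10 : f j1 != 0.
  apply: contraNneq xv1 => E; have := congr1 (coefp e) E.
  by rewrite /= coef_poly ltnSn coef0 -[inord e](_ : ord_max = _) ?inord_val //
     => [<-|]; [ | apply: val_inj; rewrite /= inordK].
have [rs Ers] := closed_field_poly_normal (f j1).
(* A good [z] keeps [p] nonzero and differs from minus the value of the first form at each root of
   the second. *)
pose qq := q * \prod_(r <- rs) ('X + ((f ord0).[r])%:P).
have qq0 : qq != 0.
  rewrite mulf_neq0 // prodf_seq_neq0; apply/allP => r _ /=.
  by rewrite -size_poly_eq0 size_XaddC.
have [z] := exists_nonroot qq0; rewrite hornerM mulf_eq0 negb_or => /andP[qz rz].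
exists (\row_i (x i + (i == v0)%:R * z)); last first.
  rewrite Eq in qz; apply: contraNneq qz => E; apply/eqP; rewrite -[RHS]E.
  by apply: meval_eq => i; rewrite mxE.
move=> s s0; set v := \row_i _.
have Ev j k : row j (vec_mx v) 0 k =
    x (mxvec_index j k) + ((j == ord0) && (k == ord0))%:R * z.
  by rewrite !mxE mxvec_index_eq.
(* At the point at infinity the second form reduces to its leading coefficient, chosen nonzero. *)
have [t0|t0] := eqVneq (s 0 ord_max) 0.
  have s00 : s 0 ord0 != 0.
    apply: contraNneq s0 => s00; apply/eqP/rowP => i; rewrite mxE.
    by case: (unliftP ord0 i) => [j ->|->//]; rewrite -t0; congr (s 0 _);
       apply: val_inj; rewrite /= /bump; case: j => [[]].
  exists j1; rewrite tnth_mktuple meval_binary_form (bigD1 ord_max) //= big1.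
    rewrite addr0 subnn expr0 mulr1 mulf_neq0 ?expf_neq0 // Ev.
    by rewrite /= mul0r addr0.
  move=> k nk; rewrite t0 expr0n subn_eq0 leqNgt.
  have -> : (k < e)%N by rewrite ltn_neqAle -ltnS ltn_ord andbT.
  by rewrite !mulr0.
pose r := s 0 ord0 / s 0 ord_max.
have Ef j : meval_row (tnth (forms v) j) s =
    s 0 ord_max ^+ e * ((f j).[r] + (j == ord0)%:R * z).
  rewrite tnth_mktuple meval_binary_form horner_poly mulrDr.
  under eq_bigr => k _ do rewrite Ev mulrDl.
  rewrite big_split /=; congr (_ + _).
    rewrite mulr_sumr; apply: eq_bigr => k _; rewrite inord_val [RHS]mulrCA.
    congr (_ * _); have lt_k : (k <= e)%N by rewrite -ltnS.
    have -> : s 0 ord_max ^+ e = s 0 ord_max ^+ (e - k) * s 0 ord_max ^+ k.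
      by rewrite -exprD subnK.
    rewrite /r expr_div_n mulrC -mulrA; congr (_ * _).
    by rewrite mulrCA mulfV ?mulr1 // expf_neq0.
  rewrite (bigD1 ord0) //= big1 ?addr0 => [|k /negPf nk].
    by rewrite andbT expr0 mul1r subn0 mulrC.
  by rewrite nk andbF !mul0r.
have [rr|nr] := boolP (root (f j1) r); last first.
  exists j1; rewrite Ef /= mul0r addr0 mulf_neq0 ?expf_neq0 //.
exists ord0; rewrite Ef eqxx mul1r mulf_neq0 ?expf_neq0 //.
have rrs : r \in rs.
  by move: rr; rewrite Ers rootZ ?lead_coef_eq0 // root_prod_XsubC.
move: rz; rewrite horner_prod (big_rem r) //= mulf_eq0 negb_or hornerD hornerX.
by rewrite hornerC addrC => /andP[].
Qed.

Lemma forms_homog (v : 'rV[K]_N) i : tnth (forms v) i \is e.-homog.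
Proof.
rewrite tnth_mktuple; apply: rpred_sum => k _; apply: rpredZ.
suff : 'X_[binary_monomial k] \is [in K[2], e.-homog] by [].
rewrite dhomogX /= mdegE big_ord_recl big_ord1 !mnmE /= subnKC //.
by rewrite -ltnS.
Qed.

Definition dehomogenize : {mpoly K[2]} -> {poly K} :=
  mmap polyC (fun i => if i == ord0 then 'X else 1).

Lemma dehomogenizeX m : dehomogenize 'X_[m] = 'X^(m ord0).
Proof.
by rewrite /dehomogenize mmapX /mmap1 big_ord_recl big_ord1 /= expr1n mulr1.
Qed.

Lemma coef_dehomogenize D (p : {mpoly K[2]}) (l : 'I_D.+1) : p \is D.-homog ->
  (dehomogenize p)`_l = p@_(binary_monomial l).
Proof.
move=> hp; rewrite [p in LHS]mpolyE [p in RHS]mpolyE.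
rewrite /dehomogenize !rmorph_sum /= coef_sum raddf_sum /= !big_seq.
apply: eq_bigr => m mp; rewrite mmapZ -/(dehomogenize _) dehomogenizeX.
rewrite coefCM coefXn mcoeffZ mcoeffX; congr (_ * (nat_of_bool _)%:R).
apply/eqP/eqP => [El|->]; last by rewrite mnmE.
have EDl : (D - l = m (lift ord0 ord0))%N.
  have := dhomog_mf hp mp; rewrite /= mdegE big_ord_recl big_ord1 -El => ED.
  by rewrite -[X in (X - _)%N]ED addKn.
apply/mnmP => i; rewrite mnmE EDl; case: (unliftP ord0 i) => [j ->|->].
  by rewrite (ord1 j).
by rewrite eqxx El.
Qed.

Definition section_coef (F : {mpoly K[n.+1]}) (l : nat) : C := (pull e F)`_l.

Lemma PhiE (F : {mpoly K[n.+1]}) (v : 'rV[K]_N) l : F \is d.-homog ->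
  Phi d F v 0 l = (section_coef F l).@[fun i => v 0 i].
Proof.
move=> hF; rewrite mxE -coef_dehomogenize; last first.
  by apply: mmap_homog => // i; apply: forms_homog.
pose psi : C -> K := meval (fun i => v 0 i).
transitivity ((map_poly psi (pull e F))`_l); last by rewrite coef_map.
suff -> : dehomogenize (F \mPo forms v) = map_poly psi (pull e F) by [].
rewrite /dehomogenize.
elim/mpoly_ring_ind: F {hF} => [c|j|p q Hp Hq|p q Hp Hq].
- by rewrite comp_mpolyC mmapC pullC map_polyC /= /psi mevalC.
- rewrite comp_mpolyXU -tnth_nth tnth_mktuple pullX.
  pose P : {poly K} := \sum_(k < e.+1) (v 0 (mxvec_index j k))%:P * 'X^k.
  transitivity P; last symmetry.
    rewrite /binary_form rmorph_sum /P /=; apply: eq_bigr => k _.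
    by rewrite mmapZ -/(dehomogenize _) dehomogenizeX mnmE mxE mxE.
  rewrite /generic_curve rmorph_sum /P /=; apply: eq_bigr => k _.
  by rewrite rmorphM /= map_polyC map_polyXn /psi /= mevalXU.
- by rewrite !rmorphD; apply: (f_equal2 +%R Hp Hq).
- by rewrite !rmorphM; apply: (f_equal2 *%R Hp Hq).
Qed.

Lemma section_coef_homog (F : {mpoly K[n.+1]}) l : F \is d.-homog ->
  section_coef F l \is d.-homog.
Proof.
move=> hF; pose H c (p : {poly C}) := forall l, p`_l \is c.-homog.
have HM a b p q : H a p -> H b q -> H (a + b)%N (p * q).
  by move=> Hp Hq k; rewrite coefM; apply: rpred_sum => i _; apply: dhomogM.
have H1 : H 0%N 1.
  move=> k; rewrite coef1; case: eqP => _; [exact: dhomog1 | exact: dhomog0].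
have Hc j : H 1%N (generic_curve K e j).
  move=> k; rewrite coef_sum; apply: rpred_sum => i _.
  rewrite coefCM coefXn; case: eqP => _; last by rewrite mulr0 rpred0.
  suff : coef_var K j i \is [in K[N], 1.-homog] by rewrite mulr1.
  by rewrite dhomogX /= mdeg1.
suff : H d (pull e F) by apply.
move=> {}l; rewrite /pull /mmap coef_sum big_seq; apply: rpred_sum => m mF.
rewrite /= coefCM mul_mpolyC; apply: rpredZ.
suff : H d (mmap1 (generic_curve K e) m) by apply.
rewrite -(dhomog_mf hF mF) /= mdegE /mmap1.
apply: (@big_rec2 _ _ H) => // j c p _ Hp; apply: (HM) => //.
elim: (m j) => [|k IHk]; first by rewrite expr0.
by rewrite exprS -add1n; apply: HM.
Qed.

Lemma size_pull_homog (F : {mpoly K[n.+1]}) : F \is d.-homog ->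
  (size (pull e F) <= (e * d).+1)%N.
Proof.
move=> hF; rewrite /pull /mmap.
apply: leq_trans (size_sum _ _ _) _; apply/bigmax_leqP_seq => m mF _.
apply: leq_trans (size_polyCM_le _ _) _.
rewrite /mmap1 -(dhomog_mf hF mF) /= mdegE big_distrr /=.
apply: (@big_rec2 _ _ (fun (a : nat) (p : {poly C}) => (size p <= a.+1)%N)).
  by rewrite size_poly1.
move=> j a p _ sp; apply: leq_trans (size_polyMleq _ _) _.
have sj : (size (generic_curve K e j ^+ m j) <= (e * m j).+1)%N.
  apply: leq_trans (size_poly_exp_leq _ _) _; rewrite ltnS leq_mul2r orbC.
  suff : (size (generic_curve K e j) <= e.+1)%N.
    by case: (size _) => // s; rewrite ltnS => ->.
  apply: leq_trans (size_sum _ _ _) _; apply/bigmax_leqP => k _.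
  apply: leq_trans (size_polyCM_le _ _) _; rewrite size_polyXn ltnS -ltnS.
  exact: ltn_ord.
by rewrite -subn1 leq_subLR add1n -addnS -addSn leq_add.
Qed.

End CurveSections.

(** * Maximal variation of the curve sections *)

Section MaximalVariation.
Variables (K : numClosedFieldType) (n e d : nat) (F : {mpoly K[n.+1]}).
Local Notation N := (n.+1 * e.+1)%N.
Local Notation C := {mpoly K[N]}.
Hypothesis smoothF : smooth_hypersurface d F.
Hypotheses (hn : (2 <= n)%N) (he : (1 <= e)%N).
Hypothesis hd : (n * n.-1 + 2 * e * n.+1 < 2 * e * d)%N.

Let d0 : (0 < d)%N. Proof. by case: (d) hd => //; rewrite muln0. Qed.

Let homF : F \is d.-homog. Proof. by case: smoothF. Qed.

(** By Euler's formula a common zero of the partial derivatives would lie on the hypersurface, as a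
    singular point. *)
Lemma partials_no_common_zero (x : 'I_n.+1 -> K) :
  (exists k, x k != 0) -> exists j, (F^`M(j)).@[x] != 0.
Proof.
move=> [k xk]; apply: contrapT => /forallNP nz.
have dF0 j : (F^`M(j)).@[x] = 0 by apply/eqP; apply: contrapT => /negP /nz.
have Fx0 : F.@[x] = 0.
  have := congr1 (meval x) (euler homF); rewrite raddf_sum mevalZ /= big1.
    by move/esym/eqP; rewrite mulf_eq0 pnatr_eq0 (gtn_eqF d0) => /eqP.
  by move=> j _; rewrite mevalM dF0 mulr0.
have [_ _ /(_ (\row_i x i))] := smoothF; rewrite /meval_row.
have Ex p : p.@[fun i => (\row_i x i) 0 i] = p.@[x].
  by apply: meval_eq => i; rewrite mxE.
case=> [||i]; rewrite ?Ex ?dF0 ?eqxx //.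
by apply: contraNneq xk => /rowP/(_ k); rewrite !mxE => ->.
Qed.

Lemma sum_mxvec_index (R : nmodType) (f : 'I_N -> R) :
  \sum_v f v = \sum_j \sum_k f (mxvec_index j k).
Proof.
rewrite (reindex _ (curry_mxvec_bij _ _)) /= pair_bigA /=.
by apply: eq_bigr => -[j k] _.
Qed.

(** [w] is a tangent vector at the generic curve killed by the differential of [Phi]. Regrouped into
    polynomials [g j] of degree at most [e], it is a syzygy of the partial derivatives of [F] along
    the curve. *)
Lemma section_jacobian (w : 'rV[C]_N) :
  (forall l : 'I_(e * d).+1, \sum_v w 0 v * (section_coef e F l)^`M(v) = 0) ->
  w = 0.
Proof.
move=> w0; pose g := \row_j (\sum_(k < e.+1) (w 0 (mxvec_index j k))%:P * 'X^k).
have coefg j (k : 'I_e.+1) : (g 0 j)`_k = w 0 (mxvec_index j k).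
  rewrite mxE coef_sum (bigD1 k) //= coefCM coefXn eqxx mulr1 big1 ?addr0 //.
  move=> k' nk; rewrite coefCM coefXn -[nat_of_ord k == _]/(k == k').
  by rewrite eq_sym (negPf nk) mulr0.
suff g0 : g = 0.
  apply/rowP; elim/mxvec_index_ind => j k; rewrite -coefg g0.
  by rewrite !mxE coef0.
have hP j : F^`M(j) \is d.-1.-homog by apply: dhomog_deriv; rewrite prednK.
apply: (no_generic_syzygy hP partials_no_common_zero he).
- have -> : (\sum_(k < n) (e + k) = n * e + 'C(n, 2))%N.
    by rewrite big_split /= sum_nat_const card_ord -bin2_sum big_mkord.
  have := mul_bin_diag n 1; rewrite bin1 => E2.
  by move: hd; rewrite E2; have := d0; case: (d) => // d' _; nia.
- move=> j; rewrite mxE; apply: leq_trans (size_sum _ _ _) _.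
  apply/bigmax_leqP => k _; apply: leq_trans (size_polyCM_le _ _) _.
  by rewrite size_polyXn ltn_ord.
transitivity (\sum_v (w 0 v)%:P * cderiv v (pull e F)).
  rewrite sum_mxvec_index; apply: eq_bigr => j _; rewrite mxE mulr_sumr.
  apply: eq_bigr => k _; rewrite mulrCA; congr (_ * _).
  rewrite /pull (derivation_mmap _ _ (derivation_cderiv _)); last exact: cderiv_const.
  rewrite (bigD1 j) //= big1 ?addr0 => [|j' nj].
    by rewrite cderiv_curve eqxx mul1r.
  by rewrite cderiv_curve (negPf nj) mul0r mulr0.
apply/polyP => l; rewrite coef0 coef_sum.
under eq_bigr => v _ do rewrite coefCM coef_cderiv.
have [ltl|gel] := ltnP l (e * d).+1; first exact: (w0 (Ordinal ltl)).
apply: big1 => v _; rewrite (leq_sizeP _ _ (size_pull_homog e homF)) //.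
by rewrite mderiv0 mulr0.
Qed.

(** The columns of a nonzero maximal minor of the Jacobian matrix select the coefficients. *)
Lemma independent_section_coefs : exists c : 'I_N -> 'I_(e * d).+1,
  forall R : {mpoly K[N]}, R != 0 ->
    mmap (@mpolyC N K) (fun i => section_coef e F (c i)) R != 0.
Proof.
pose M : 'M[C]_(N, (e * d).+1) := \matrix_(v, l) (section_coef e F l)^`M(v).
have freeM : row_free (map_mx (@tofrac C) M).
  apply: row_free_tofrac => w wM; apply: section_jacobian => l.
  have := congr1 (fun u : 'rV_(e * d).+1 => u 0 l) wM; rewrite !mxE => E.
  by rewrite -[RHS]E; apply: eq_bigr => v _; rewrite mxE.
have [c detc] := exists_minor_neq0 freeM.
exists c; apply: jacobian_criterion => w w0.
have A0 : colsub c M *m w^T = 0.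
  apply/matrixP => v i; rewrite !mxE -[RHS](w0 v); apply: eq_bigr => l _.
  by rewrite !mxE (ord1 i) mulrC.
have := congr1 (mulmx (\adj (colsub c M))) A0.
rewrite mulmxA mul_adj_mx mulmx0 mul_scalar_mx => /eqP.
rewrite scalemx_eq0 (negPf detc) /= => /eqP/(congr1 trmx).
by rewrite trmxK trmx0.
Qed.

(** Functions on the image pull back along [Phi], so the image has at most the dimension of the
    source. *)
Lemma Mor_has_indep_of_image m :
  has_indep_functions (rational_image (@Mor K n e) (@Phi K n e d F)) m ->
  has_indep_functions (@Mor K n e) m.
Proof.
move=> [k [h [g [hh hg indep]]]].
pose sub (p : {mpoly K[(e * d).+1]}) : C :=
  mmap (@mpolyC N K) (fun l => section_coef e F l) p.
have hsub p : p \is k.-homog -> sub p \is (d * k).-homog.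
  by move=> hp; apply: mmap_homog => // l; apply: section_coef_homog.
have Esub p v : meval_row (sub p) v = meval_row p (Phi d F v).
  rewrite /meval_row meval_mmap; apply: meval_eq => l.
  by rewrite PhiE.
exists (d * k)%N, (sub h), (fun i => sub (g i)); split=> [|i|P /indep].
- exact: hsub.
- exact: hsub.
move=> [_ [[v [Mv _ ->]] hv Pv]]; exists v; split=> //; first by rewrite Esub.
apply: contraNneq Pv => E; apply/eqP; rewrite -[RHS]E; apply: meval_eq => i.
by rewrite !Esub.
Qed.

Theorem curve_sections_vary_maximally_nat : curve_sections_vary_maximally e d F.
Proof.
(* The dimension of the source; [a.+1] is convertible to [N], as the lemmas on dimension require. *)
pose a := (e + n * e.+1)%N; have n0 : (0 < n)%N by apply: leq_trans hn.
have leMor m : has_indep_functions (@Mor K n e) m -> (m <= a)%N.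
  exact: (@indep_functions_lt K a (@Mor K n e)).
(* The bound on [d] gives this because [n (n - 1) / 2 + 1 >= n]; the minimum of the two dimensions
   is then [a]. *)
have le_a : (a <= e * d)%N by rewrite /a; move: hd hn; nia.
exists a, (e * d)%N; split.
- split=> //; apply: (@has_indep_coordinates K N a _ id) => R R0.
  exact: (Mor_dense n0 R0).
- split; last by move=> m /indep_functions_lt.
  apply: (@has_indep_coordinates K _ _ _ id) => R R0.
  have [|x] := @exists_mnonroot K _ (R * 'X_ord0).
    by rewrite mulf_neq0 // -msize_poly_eq0 msizeX.
  rewrite mevalM mevalXU mulf_eq0 negb_or => /andP[Rx x0].
  exists (\row_i x i).
    by apply: contraNneq x0 => /rowP/(_ ord0); rewrite !mxE => ->.
  apply: contraNneq Rx => E; apply/eqP; rewrite -[RHS]E; apply: meval_eq => i.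
  by rewrite mxE.
rewrite (minn_idPl le_a); split; last by move=> m /Mor_has_indep_of_image/leMor.
have [c indep] := independent_section_coefs.
apply: (@has_indep_coordinates K _ a _ c) => R R0.
(* The extra factor makes a coordinate of [Phi d F v] nonzero, so that the rational map is defined
   at [v]. *)
have RX0 : R * 'X_ord0 != 0 by rewrite mulf_neq0 // -msize_poly_eq0 msizeX.
have [v Mv] := Mor_dense n0 (indep _ RX0).
rewrite meval_mmap mevalM mevalXU mulf_eq0 negb_or => /andP[Rv v0].
exists (Phi d F v).
  exists v; split=> //; apply: contraNneq v0 => E.
  by rewrite -PhiE // E mxE.
apply: contraNneq Rv => E; apply/eqP; rewrite -[RHS]E; apply: meval_eq => i.
by rewrite PhiE.
Qed.

End MaximalVariation.

Theorem theorem5p2 (R : realType) (n e d : nat) (F : {mpoly R[i][n.+1]})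
  (hn : (2 <= n)%N) (he : (1 <= e)%N)
  (hX : smooth_hypersurface d F)
  (hd : n%:Q * (n%:Q - 1) / (2 * e%:Q) + n%:Q + 1 < d%:Q) :
  curve_sections_vary_maximally e d F.
Proof.
apply: curve_sections_vary_maximally_nat => //.
have e0 : 0 < 2 * e%:Q by rewrite mulr_gt0 // ltr0n.
move: hd; rewrite -addrA -(ltr_pM2r e0) mulrDl divfK ?gt_eqF //.
rewrite -(ltr_nat rat) !(natrD, natrM) -!pmulrn -subn1 natrB; last exact: leq_trans hn.
by rewrite -[n.+1%:R]natr1 [d%:R * _]mulrC [(n%:R + 1) * _]mulrC.
Qed.
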